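(* Let $\mathcal{L}:\mathbb{R}^d\to\mathbb{R}$ attain its minimum, put $\mathcal{L}_*:=\min\mathcal{L}$, let $\sigma>0$, and let $w_t$ be the solution of $dw_t=-\nabla\mathcal{L}(w_t)\,dt+\sqrt{2\sigma}\,dB_t$ with $w_0=0$. Assume that, for $R>0$ sufficiently large and with constants $\ell_1',\ell_2'>0$ uniform with respect to $R$, the following conditions hold: $$\mathcal{L}(w)-\mathcal{L}_*\le\frac{1}{\ell_1'}\|\nabla\mathcal{L}(w)\|^2\quad\text{for all }w\in B_R(0),$$ $$|\Delta\mathcal{L}(w)|\le\ell_2'\quad\text{for all }w\in B_R(0),$$ $$\|\nabla\mathcal{L}(w)\|^2\le\ell_3'(1+\|w\|^2)\quad\text{for all }w\in B_R(0)\text{ and some }\ell_3'>0.$$ For any $T>0$ define $\Omega_{R,T}:=\{\omega:\sup_{t\in[0,T]}\|w_t(\omega)\|\le R\}$. Then $$\mathbb{E}[\mathcal{L}(w_t)-\mathcal{L}_*\mid\Omega_{R,T}]\le\frac{(\mathcal{L}(0)-\mathcal{L}_* )e^{-\ell_1't}+\sigma\ell_2'\,\frac{1-e^{-\ell_1't}}{\ell_1'}}{\mathbb{P}(\Omega_{R,T})},\qquad t\in[0,T].$$ Moreover, for any $\epsilon>0$, $\sigma>0$, $\delta>0$, and for $T$ large enough, $$\mathbb{P}(\{\mathcal{L}(w_T)-\mathcal{L}_*\le\epsilon\})\ge1-\Big(\frac{2\sigma\ell_2'/\ell_1'}{\epsilon}+\delta\Big).$$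
   Context: $B_t$ is a $d$-dimensional Brownian motion and $B_R(0)$ is the ball of radius $R$ centered at $0$ in $\mathbb{R}^d$. The constants $\ell_1',\ell_2'$ are uniform in the sense that they do not depend on $R$, where $R$ may be taken arbitrarily large. *)

(* Defs.v *)
(* MathComp-Analysis.  Time is indexed by the reals and every condition is
   restricted to nonnegative times; values of processes at t < 0 are junk. *)
From mathcomp Require Import all_boot all_order all_algebra.
From mathcomp Require Import all_classical all_reals all_analysis.
Import Order.TTheory GRing.Theory Num.Theory.
Import numFieldNormedType.Exports.

Set Implicit Arguments.
Unset Strict Implicit.
Unset Printing Implicit Defensive.

Local Open Scope classical_set_scope.
Local Open Scope ring_scope.

Section calculus.
Context {R : realType} {d : nat}.
Implicit Types (f : 'rV[R]_d -> R) (x : 'rV[R]_d) (r : R).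

(* The library norm on ['rV[R]_d] is the sup norm; it induces the same topology
   and derivatives, but balls and lengths have to be Euclidean. *)
Definition enorm x : R := Num.sqrt (\sum_(i < d) x 0 i ^+ 2).

Definition eball r : set 'rV[R]_d := [set x | enorm x < r].

Definition pderiv (i : 'I_d) f : 'rV[R]_d -> R := 'D_(delta_mx 0 i) f.

Definition grad f x : 'rV[R]_d := \row_i pderiv i f x.

Definition laplacian f x : R := \sum_(i < d) pderiv i (pderiv i f) x.

(* The partial derivatives up to order two exist everywhere and are continuous;
   existence has to be required because ['D_v f] is total. *)
Record C2 f : Prop := {
  C2_cont : continuous f;
  C2_derivable : forall i x, derivable f x (delta_mx 0 i);
  C2_cont1 : forall i, continuous (pderiv i f);
  C2_derivable2 : forall i j x, derivable (pderiv i f) x (delta_mx 0 j);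
  C2_cont2 : forall i j, continuous (pderiv j (pderiv i f)) }.

Definition is_minimum f (m : R) : Prop :=
  (exists x, f x = m) /\ forall x, m <= f x.

End calculus.

Section processes.
Context {R : realType} {d : nat} {disp : measure_display}
  {Omega : measurableType disp}.
Implicit Types (P : probability Omega R) (F : R -> set (set Omega))
  (X B w : R -> Omega -> 'rV[R]_d) (Y : Omega -> 'rV[R]_d).

Definition sigma_of Y : set (set Omega) :=
  g_sigma_preimage (fun (i : 'I_d) omega => Y omega 0 i).

(* Neither completeness nor right-continuity is assumed. *)
Record is_filtration F : Prop := {
  filtration_sigma : forall t, 0 <= t -> sigma_algebra setT (F t);
  filtration_sub : forall t, 0 <= t -> F t `<=` measurable;
  filtration_mono : forall s t, 0 <= s -> s <= t -> F s `<=` F t }.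

Definition adapted F X : Prop := forall t, 0 <= t -> sigma_of (X t) `<=` F t.

Definition continuous_paths X : Prop :=
  forall omega, {within `[0, +oo[, continuous (fun t => X t omega)}.

Definition indep_classes P (G H : set (set Omega)) : Prop :=
  forall A C, G A -> H C -> P (A `&` C) = (P A * P C)%E.

(* [Y] has law N(0, v I_d), the d-fold product of N(0, v); the second argument
   of [normal_prob] is the standard deviation. *)
Definition centered_gaussian P Y (v : R) : Prop :=
  forall A : 'I_d -> set R, (forall i, measurable (A i)) ->
    P [set omega | forall i, A i (Y omega 0 i)] =
    (\prod_(i < d) normal_prob (0 : R) (Num.sqrt v) (A i))%E.

(* Standard d-dimensional Brownian motion relative to the filtration [F]. *)
Record brownian_motion P F B : Prop := {
  bm_adapted : adapted F B;
  bm_continuous : continuous_paths B;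
  bm_start : {ae P, forall omega, B 0 omega = 0};
  bm_indep : forall s t, 0 <= s -> s < t ->
    indep_classes P (F s) (sigma_of (fun omega => B t omega - B s omega));
  bm_gaussian : forall s t, 0 <= s -> s < t ->
    centered_gaussian P (fun omega => B t omega - B s omega) (t - s) }.

(* dw_t = - grad L (w_t) dt + sqrt (2 sigma) dB_t with w_0 = 0, in integral
   form.  Since the noise coefficient is constant, the stochastic integral is
   sqrt (2 sigma) B_t and no Ito integral is needed. *)
Record langevin_solution P F B (L : 'rV[R]_d -> R) (sigma : R) w : Prop := {
  langevin_adapted : adapted F w;
  langevin_continuous : continuous_paths w;
  langevin_start : {ae P, forall omega, w 0 omega = 0};
  langevin_eq : {ae P, forall omega, forall t, 0 <= t -> forall i : 'I_d,
    w t omega 0 i = w 0 omega 0 i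
      - (\int[lebesgue_measure]_(s in `[0, t]) grad L (w s omega) 0 i)
      + Num.sqrt (2 * sigma) * B t omega 0 i} }.

Definition confined w (r T : R) : set Omega :=
  [set omega | (ereal_sup [set (enorm (w t omega))%:E | t in `[0%R, T]] <=
                r%:E)%E].

(* E[Y | A] = E[Y 1_A] / P(A) for an event [A].  In [\bar R], 0 / 0 = 0, which
   is the value when P(A) = 0. *)
Definition cond_expectation P (Y : Omega -> R) (A : set Omega) : \bar R :=
  ((\int[P]_(omega in A) (Y omega)%:E) / P A)%E.

End processes.

(* Main.v *)
Require Import Defs.
From HB Require Import structures.
From mathcomp Require Import all_boot all_order all_algebra.
From mathcomp Require Import ring lra.
From mathcomp Require Import all_classical all_reals all_analysis.
From mathcomp Require Import measurable_realfun.
Import Order.TTheory GRing.Theory Num.Theory.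
Import numFieldNormedType.Exports.

Local Open Scope classical_set_scope.
Local Open Scope ring_scope.

(** Put g := L - Lstar.  Both inequalities follow from
    E g(w_t) <= g(0) e^(-l1 t) + sigma l2 (1 - e^(-l1 t)) / l1,
    the second one by Markov's inequality.  Ito's formula is replaced by an Euler
    scheme of mesh h = t / N.  For given r, rho, eta let the event A_k say that up
    to time kh the grid values of w stay in the ball of radius r, the Brownian
    increments are at most rho, and each step of w differs from the Euler step by
    at most h eta.  These events are adapted and decreasing in k.  As g >= 0, one
    may pass from A_(k+1) to A_k and replace the increment, which on A_(k+1) is
    at most rho, by its truncation at rho; a Taylor expansion of order two,
    independence, and the PL and Laplacian bounds (global, since they hold on
    all large balls) give
    E[g(w_((k+1)h)); A_(k+1)] <= (1 - l1 h) E[g(w_kh); A_k] + h (sigma l2 + e)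
    for small rho, eta and h.  A discrete Gronwall argument bounds E[g(w_t); A_N].
    Continuity of the paths puts almost every omega whose path stays in the ball
    of radius r into A_N for all large N, so Fatou's lemma, applied to N -> oo and
    then to r -> oo, yields the bound on E g(w_t). *)

(** * Calculus on row vectors *)

Section sup_norm.
Context {R : realType} {d : nat}.
Implicit Types x : 'rV[R]_d.

Lemma rV_norm_le x r : 0 <= r -> (`|x| <= r) <-> forall i, `|x 0 i| <= r.
Proof.
move=> r0; rewrite [`|x|]/Num.norm /= mx_normrE; split.
  by move=> /bigmax_leP[_ h] i; exact: (h (0, i)).
move=> h; apply/bigmax_leP; split => // -[i j] _ /=.
by rewrite ord1; exact: h.
Qed.

Lemma rV_coord_le x i : `|x 0 i| <= `|x|.
Proof. by have /rV_norm_le := lexx `|x|; exact. Qed.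

(** The norm is the sup norm, so the ball is a cube: a product of segments, compact by Tychonoff. *)
Lemma compact_rV_ball (r : R) : compact [set x : 'rV[R]_d | `|x| <= r].
Proof.
have [r0|r0] := leP 0 r; last first.
  have -> : [set x : 'rV[R]_d | `|x| <= r] = set0.
    apply/seteqP; split=> // x /= xr.
    by have := normr_ge0 x; rewrite leNgt (le_lt_trans xr r0).
  exact: compact0.
have -> : [set x : 'rV[R]_d | `|x| <= r] =
    [set x | forall i, `[- r, r]%classic (x ord0 i)].
  apply/seteqP; split=> x /=.
    by move=> /rV_norm_le h i; rewrite in_itv/= -ler_norml h.
  by move=> h; apply/rV_norm_le => // i; have := h i; rewrite in_itv/= -ler_norml.
by apply: (@rV_compact R d (fun=> `[- r, r]%classic)) => i; exact: segment_compact.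
Qed.

End sup_norm.

(** Heine-Cantor in an asymmetric form: only [x] is confined to the compact set, while [y] ranges
    over [A], so a displacement may leave [K]. The near-covering form of compactness makes the
    modulus at each point uniform. *)
Lemma compact_unif_continuous {R : realType} (U V : normedModType R)
    (A K : set U) (f : U -> V) (e : R) :
  compact K -> K `<=` A -> {within A, continuous f} -> 0 < e ->
  exists2 del, 0 < del &
    forall x y, K x -> A y -> `|x - y| < del -> `|f x - f y| < e.
Proof.
move=> /compact_near_coveringP/near_covering_withinP cK KA cf e0.
pose Q (del : R) (x : U) := forall y, A y -> `|x - y| < del -> `|f x - f y| < e.
have /cK : forall x, K x -> \forall x' \near x & del \near 0^'+, K x' -> Q del x'.
  move=> x Kx.
  have /subspace_continuousP/(_ x (KA _ Kx)) := cf.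
  move=> /cvgrPdist_lt /(_ (e / 2)).
  rewrite divr_gt0// => /(_ isT); rewrite near_withinE.
  move=> /nbhs_normP[rho rho0 h].
  have rho20 : 0 < rho / 2 by rewrite divr_gt0.
  exists (ball x (rho / 2), [set del | 0 < del < rho / 2]) => /=.
    split; first exact: nbhsx_ballx.
    near=> del => /=; apply/andP; split=> //.
  case=> x' del /= [+ /andP[del0 dl]] Kx' y Ay xy.
  rewrite -ball_normE /= => xx'.
  have h1 : `|f x - f x'| < e / 2.
    apply: h; [|exact: KA].
    by rewrite /ball_ /= (lt_trans xx')// ltr_pdivrMr// ltr_pMr// ltrDl.
  have h2 : `|f x - f y| < e / 2.
    apply: h => //; rewrite /ball_ /= -(subrK x' x) -addrA.
    rewrite (le_lt_trans (ler_normD _ _))// [ltRHS](splitr rho) ltrD//.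
    exact: lt_trans dl.
  rewrite -(subrK (f x) (f x')) -addrA (le_lt_trans (ler_normD _ _))//.
  by rewrite (splitr e) ltrD// distrC.
move=> H.
have : \forall del \near (0:R)^'+, 0 < del /\ K `<=` Q del.
  by near=> del; split=> //; near: del; exact: H.
case/(@filter_ex _ _ _) => del [del0 KQ]; exists del => // x y Kx Ay.
exact: KQ.
Unshelve. all: by end_near. Qed.

Section coordinate_calculus.
Context {R : realType} {d : nat}.
Implicit Types (f : 'rV[R]_d -> R) (x z : 'rV[R]_d) (i j : 'I_d).

Lemma is_derive_coord_line f x i (s : R) : (forall x, derivable f x (delta_mx 0 i)) ->
  is_derive s 1 (fun s : R => f (x + s *: delta_mx 0 i))
    (pderiv i f (x + s *: delta_mx 0 i)).
Proof.
move=> df.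
have E : (fun h : R => h^-1 *: (((fun s => f (x + s *: delta_mx 0 i)) \o shift s) (h *: 1)
      - f (x + s *: delta_mx 0 i))) =
    (fun h : R => h^-1 *: ((f \o shift (x + s *: delta_mx 0 i)) (h *: delta_mx 0 i)
      - f (x + s *: delta_mx 0 i))).
  apply/funext => h /=; congr (_ *: (f _ - _)).
  by rewrite [h *: 1]mulr1 scalerDl addrCA.
split; first by rewrite /derivable E; exact: df.
by rewrite /derive E.
Qed.

Lemma MVT0 (phi dphi : R -> R) (s : R) :
  (forall s : R, is_derive s 1 phi (dphi s)) ->
  exists2 c, `|c| <= `|s| & phi s - phi 0 = dphi c * s.
Proof.
move=> dph.
have cont : continuous phi.
  by move=> u; apply/differentiable_continuous/derivable1_diffP.
have [s0|s0] := leP 0 s.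
  have [c + h] := @MVT_segment _ phi dphi _ _ s0 (fun u _ => dph u)
    (continuous_subspaceT cont).
  rewrite in_itv/= => /andP[c0 cs]; exists c; rewrite ?h ?subr0//.
  by rewrite !ger0_norm.
have [c + h] := @MVT_segment _ phi dphi _ _ (ltW s0) (fun u _ => dph u)
    (continuous_subspaceT cont).
rewrite in_itv/= => /andP[c0 cs]; exists c.
  by rewrite !ler0_norm ?lerN2// ltW.
by rewrite -opprB h sub0r mulrN opprK.
Qed.

(** Move from [x] to [x + z] one coordinate at a time: the increments telescope and each leg is a
    one-variable mean value theorem. The intermediate points differ from leg to leg, whence a family
    [q]. *)
Lemma mvt_coord f x z : (forall i x, derivable f x (delta_mx 0 i)) ->
  exists2 q : 'I_d -> 'rV[R]_d, (forall i, `|q i| <= `|z|) &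
    f (x + z) - f x = \sum_i z 0 i * pderiv i f (x + q i).
Proof.
move=> df.
(* [tr k] keeps the first [k] coordinates of [z]; the leg number [i] runs from [x + tr i] to
   [x + tr i.+1]. *)
pose tr k : 'rV[R]_d := \row_i (if (i < k)%N then z 0 i else 0).
have trS i : tr i.+1 = tr i + z 0 i *: delta_mx 0 i.
  apply/rowP => j; rewrite !mxE eqxx/=; have [->|ji] := eqVneq j i.
    by rewrite ltnSn ltnn mulr1 add0r.
  by rewrite mulr0 addr0 ltnS leq_eqVlt (inj_eq val_inj) (negbTE ji).
have /choice[c cP] i : exists c, `|c| <= `|z 0 i| /\
    f (x + tr i.+1) - f (x + tr i) =
    z 0 i * pderiv i f (x + (tr i + c *: delta_mx 0 i)).
  have [c c1 c2] := @MVT0 _ _ (z 0 i)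
    (fun s => is_derive_coord_line f (x + tr i) i s (df i)).
  exists c; split=> //; rewrite trS addrA [in RHS]addrA mulrC -c2.
  by rewrite scale0r addr0.
exists (fun i => tr i + c i *: delta_mx 0 i) => [i|].
  apply/rV_norm_le => // j; rewrite !mxE eqxx/=.
  have [->|ji] := eqVneq j i.
    rewrite ltnn add0r mulr1; exact: le_trans (cP i).1 (rV_coord_le _ _).
  by rewrite mulr0 addr0; case: ifP; rewrite ?rV_coord_le ?normr0.
under eq_bigr do rewrite -(cP _).2.
rewrite -(big_mkord xpredT (fun k => f (x + tr k.+1) - f (x + tr k))).
rewrite telescope_sumr//.
congr (f (x + _) - f _); apply/rowP => i; rewrite !mxE ?ltn_ord//.
by rewrite addr0.
Qed.

(* The expansion of [mvt_coord] at h *: z, as h -> 0: this replaces Frechet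
   differentiability, of which only the partial derivatives are assumed. *)
Lemma is_derive_line f x z (s : R) :
  (forall i x, derivable f x (delta_mx 0 i)) ->
  (forall i, continuous (pderiv i f)) ->
  is_derive s 1 (fun s : R => f (x + s *: z))
    (\sum_i z 0 i * pderiv i f (x + s *: z)).
Proof.
move=> df cf.
have /choice[q qP] (h : R) : exists q : 'I_d -> 'rV[R]_d,
    (forall i, `|q i| <= `|h *: z|) /\
    f (x + s *: z + h *: z) - f (x + s *: z) =
    \sum_i (h *: z) 0 i * pderiv i f (x + s *: z + q i).
  by have [q q1 q2] := mvt_coord f (x + s *: z) (h *: z) df; exists q.
have H : (h^-1 *: (((fun s => f (x + s *: z)) \o shift s) (h *: 1) - f (x + s *: z)))
    @[h --> 0^'] --> \sum_i z 0 i * pderiv i f (x + s *: z).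
  have q0 i : q h i @[h --> 0^'] --> (0 : 'rV[R]_d).
    apply/cvgr0Pnorm_lt => e e0; near=> h.
    have hz : `|h| * `|z| < e.
      rewrite (@le_lt_trans _ _ (`|h| * (1 + `|z|)))//.
        by rewrite ler_wpM2l// lerDr.
      have z1 : 0 < 1 + `|z| by rewrite ltr_pwDl.
      rewrite -ltr_pdivlMr//; near: h; apply: dnbhs0_lt; exact: divr_gt0.
    by rewrite (le_lt_trans ((qP h).1 i))// normrZ.
  have C : (\sum_i z 0 i * pderiv i f (x + s *: z + q h i)) @[h --> 0^'] -->
      \sum_i z 0 i * pderiv i f (x + s *: z).
    apply: cvg_big => [|i _]; first exact: add_continuous.
     apply: cvgMr.
    have E : (x + s *: z + q h i) @[h --> 0^'] --> x + s *: z.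
      rewrite -[X in _ --> X]addr0.
      by apply: cvgD; [exact: cvg_cst|exact: q0].
    exact: (cvg_comp _ _ E (cf i _)).
  apply: cvg_trans C; apply: near_eq_cvg; near=> h => /=.
  have h0 : h != 0 by near: h; exact: nbhs_dnbhs_neq.
  rewrite [h *: 1]mulr1 scalerDl addrCA (addrC (h *: z)) (qP h).2.
  rewrite scaler_sumr; apply: eq_bigr => i _.
  by rewrite mxE /GRing.scale/= mulrA mulrA mulVf// mul1r.
split; first by apply/cvg_ex; eexists; exact: H.
exact: cvg_lim H.
Unshelve. all: by end_near. Qed.
End coordinate_calculus.

(** * Taylor bounds, uniform on balls *)

Section taylor.
Context {R : realType} {d : nat}.
Implicit Types (f : 'rV[R]_d -> R) (x z : 'rV[R]_d) (i j : 'I_d) (r e : R).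

Lemma continuous_bounded_rV_ball f r : continuous f ->
  exists2 M, 0 < M & forall x, `|x| <= r -> `|f x| <= M.
Proof.
move=> cf.
have /compact_bounded[M [Mr MP]] := continuous_compact
  (continuous_subspaceT cf) (@compact_rV_ball R d r).
exists (`|M| + 1) => [|x xr]; first by rewrite ltr_wpDl.
apply: (MP (`|M| + 1)); last by exists x.
by rewrite (le_lt_trans (ler_norm _))// ltrDl.
Qed.

Lemma unif_continuous_family (I : finType) (h : I -> 'rV[R]_d -> R) r e :
  (forall k, continuous (h k)) -> 0 < e ->
  exists2 rho, 0 < rho & forall k x z, `|x| <= r -> `|z| <= rho ->
    `|h k (x + z) - h k x| <= e.
Proof.
move=> ch e0.
have /choice[del dP] k : exists del, 0 < del /\ forall x y, `|x| <= r ->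
    `|x - y| < del -> `|h k x - h k y| < e.
  have [del d0 dP] := @compact_unif_continuous R 'rV[R]_d R setT _ (h k) e
    (@compact_rV_ball R d r) (@subsetT _ _) (continuous_subspaceT (ch k)) e0.
  by exists del; split=> // x y xr; exact: dP.
(* The minimum over the finite family serves every member; halving it turns the nonstrict bound on
   [z] into a strict one. *)
exists ((\big[Num.min/1]_k del k) / 2) => [|k x z xr zd].
  by rewrite divr_gt0//; apply/bigmin_gtP; split=> // k _; have [] := dP k.
rewrite distrC ltW//; apply: (dP k).2 => //.
rewrite opprD addrA subrr sub0r normrN (le_lt_trans zd)//.
rewrite ltr_pdivrMr//.
have [d0 _] := dP k.
apply: (@le_lt_trans _ _ (del k)); first exact: bigmin_le_cond.
by rewrite ltr_pMr// ltrDl.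
Qed.

Lemma C1_lipschitz f r : (forall i x, derivable f x (delta_mx 0 i)) ->
  (forall i, continuous (pderiv i f)) ->
  exists2 M, 0 < M & forall x y, `|x| <= r -> `|y| <= r ->
    f y <= f x + M * `|y - x|.
Proof.
move=> df cf.
(* The mean value points are [x + q i] with [q i] at most |y - x| <= 2r in norm, hence the radius
   3r. *)
have /choice[M MP] i : exists M, 0 < M /\ forall x, `|x| <= r + (r + r) -> `|pderiv i f x| <= M.
  by have [M M0 MP] := continuous_bounded_rV_ball _ (r + (r + r)) (cf i); exists M.
have S0 : 0 <= \sum_i M i by apply: sumr_ge0 => i _; rewrite ltW// (MP i).1.
exists (1 + \sum_i M i) => [|x y xr yr]; first by rewrite ltr_pwDl.
have [q q1 q2] := mvt_coord f x (y - x) df.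
rewrite -lerBlDl; move: q2; rewrite (addrC x) subrK => ->.
rewrite mulrDl mul1r mulr_suml -[leLHS]add0r lerD//.
apply: ler_sum => i _; rewrite mulrC (le_trans (ler_norm _))// normrM.
rewrite ler_pM// ?rV_coord_le//; apply: (MP i).2.
rewrite (le_trans (ler_normD _ _))// lerD// (le_trans (q1 i))//.
by rewrite (le_trans (ler_normB _ _))// lerD.
Qed.

Lemma C1_expansion f r e : (forall i x, derivable f x (delta_mx 0 i)) ->
  (forall i, continuous (pderiv i f)) -> 0 < e ->
  exists2 rho, 0 < rho & forall x z, `|x| <= r -> `|z| <= rho ->
    f (x + z) <= f x + \sum_i z 0 i * pderiv i f x + e * `|z|.
Proof.
move=> df cf e0.
(* Each of the d coordinates contributes an error of at most |z| e / (1 + d); the summand 1 keeps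
   the denominator positive when d = 0. *)
have d0 : 0 < 1 + d%:R :> R by rewrite ltr_pwDl.
have [rho rho0 rP] := unif_continuous_family _ _ r _ cf (divr_gt0 e0 d0).
exists rho => // x z xr zr.
have [q q1 q2] := mvt_coord f x z df.
rewrite -addrA -lerBlDl q2 -lerBlDl -sumrB.
apply: (@le_trans _ _ (\sum_(i < d) `|z| * (e / (1 + d%:R)))).
  apply: ler_sum => i _; rewrite -mulrBr (le_trans (ler_norm _))// normrM.
  by rewrite ler_pM// ?rV_coord_le// rP// (le_trans (q1 i)).
rewrite sumr_const card_ord -[leLHS]mulr_natr -mulrA [leRHS]mulrC.
rewrite ler_wpM2l//.
by rewrite mulrAC ler_pdivrMr// ler_wpM2l ?(ltW e0)// lerDr.
Qed.

(** Apply the mean value theorem on [0, 1] to [psi], which is f along the segment minus its first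
    and second order terms. Its derivative compares the gradient with its linearization, and
    [mvt_coord] on each partial derivative reduces this to the uniform continuity of the second
    ones. The error is stated through the sum of squares because this becomes a variance later. *)
Lemma C2_expansion f r e : C2 f -> 0 < e ->
  exists2 rho, 0 < rho & forall x z, `|x| <= r -> `|z| <= rho ->
    f (x + z) <= f x + \sum_i z 0 i * pderiv i f x
      + 2^-1 * (\sum_i \sum_j z 0 i * z 0 j * pderiv j (pderiv i f) x)
      + e * \sum_i z 0 i ^+ 2.
Proof.
move=> [_ df cf ddf ccf] e0.
have d0 : 0 < 1 + d%:R :> R by rewrite ltr_pwDl.
have [rho rho0 rP] := unif_continuous_family _
  (fun k : 'I_d * 'I_d => pderiv k.2 (pderiv k.1 f)) r _
  (fun k => ccf k.1 k.2) (divr_gt0 e0 d0).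
exists rho => // x z xr zr.
pose a := \sum_i z 0 i * pderiv i f x.
pose Q := \sum_i \sum_j z 0 i * z 0 j * pderiv j (pderiv i f) x.
pose psi (s : R) := f (x + s *: z) - a * s - Q * (2^-1 * s ^+ 2).
have dpsi (s : R) : is_derive s 1 psi (\sum_i z 0 i * pderiv i f (x + s *: z) - a - Q * s).
  have h := is_derive_line f x z s df cf; rewrite /psi.
  apply: is_derive_eq.
  rewrite /GRing.scale/= !mulr1; congr (_ - _ - _ * _).
  lra.
have cpsi : continuous psi.
  by move=> s; apply/differentiable_continuous/derivable1_diffP.
have [c] := @MVT _ _ _ _ _ (ltr01 : 0 < 1 :> R) (fun s _ => dpsi s)
  (continuous_subspaceT cpsi).
rewrite in_itv/= => /andP[c0 c1].
rewrite /psi scale1r scale0r addr0 subr0 mulr1 expr1n mulr1 expr0n/= !mulr0 !subr0.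
rewrite mulr1 -/a -/Q => E.
rewrite -[f (x + z)](subrK (f x)).
suff : \sum_i z 0 i * pderiv i f (x + c *: z) - a - Q * c <= e * \sum_i z 0 i ^+ 2.
  by move: E; lra.
rewrite /a /Q -sumrB mulr_suml -sumrB.
apply: (@le_trans _ _ (\sum_i \sum_j `|z 0 i| * `|z 0 j| * (e / (1 + d%:R)))).
  apply: ler_sum => i _.
  have [q q1 q2] := mvt_coord (pderiv i f) x (c *: z) (ddf i).
  rewrite -mulrBr q2 mulr_sumr mulr_suml -sumrB; apply: ler_sum => j _.
  rewrite mxE (le_trans (ler_norm _))//.
  rewrite (_ : _ - _ = c * (z 0 i * z 0 j *
     (pderiv j (pderiv i f) (x + q j) - pderiv j (pderiv i f) x))); last by ring.
  rewrite normrM -[leRHS]mul1r ler_pM//.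
    by rewrite ler_norml; apply/andP; split; lra.
  rewrite !normrM ler_wpM2l ?mulr_ge0//.
  apply: (rP (i, j)) => //=.
  rewrite (le_trans (q1 j))// normrZ (le_trans _ zr)// ler_piMl//.
  by rewrite ler_norml; apply/andP; split; lra.
(* |z_i| |z_j| <= (z_i^2 + z_j^2) / 2 turns the double sum into d times the sum of squares. *)
apply: (@le_trans _ _ (\sum_(i < d) \sum_(j < d)
    (2^-1 * (z 0 i ^+ 2 + z 0 j ^+ 2)) * (e / (1 + d%:R)))).
  apply: ler_sum => i _; apply: ler_sum => j _.
  rewrite ler_wpM2r//; first by rewrite divr_ge0 ?ltW.
  have := sqr_ge0 (`|z 0 i| - `|z 0 j|).
  by rewrite -(real_normK (num_real (z 0 i))) -(real_normK (num_real (z 0 j))); nra.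
rewrite -(eq_bigr _ (fun i _ => mulr_suml _ _ _ _)) -mulr_suml.
have -> : \sum_(i < d) \sum_(j < d) 2^-1 * (z 0 i ^+ 2 + z 0 j ^+ 2) =
    d%:R * \sum_i z 0 i ^+ 2.
  rewrite -(eq_bigr _ (fun i _ => mulr_sumr _ _ _ _)) -mulr_sumr.
  under eq_bigr do rewrite big_split/= sumr_const card_ord.
  rewrite big_split/= sumr_const card_ord sumrMnl -mulr2n -(mulr_natl (\sum_i _)).
  by rewrite mulr2n; lra.
have S0 : 0 <= \sum_i z 0 i ^+ 2 by apply: sumr_ge0 => i _; exact: sqr_ge0.
rewrite (mulrC d%:R) -mulrA [leRHS]mulrC ler_wpM2l//.
by rewrite mulrA ler_pdivrMr// mulrC ler_wpM2l ?(ltW e0)// lerDr.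
Qed.

End taylor.

(** * Measurability and independence *)

Section measurable_coordinates.
Context {R : realType} {d : nat} {disp : measure_display} {T : measurableType disp}.
Implicit Types (Y : T -> 'rV[R]_d) (G : 'rV[R]_d -> R).

Lemma measurable_fun_rV_norm_lt Y (q : 'rV[R]_d) (e : R) : 0 < e ->
  (forall i, measurable_fun setT (fun w => Y w 0 i)) ->
  measurable [set w | `|Y w - q| < e].
Proof.
move=> e0 mY.
have -> : [set w | `|Y w - q| < e] =
    \bigcap_(i in [set: 'I_d]) ((fun w => Y w 0 i) @^-1` (ball (q 0 i) e)).
  apply/seteqP; split=> w /=.
    move=> h i _ /=; rewrite -ball_normE/= distrC.
    by have := rV_coord_le (Y w - q) i; rewrite !mxE => /le_lt_trans; apply.
  move=> h; rewrite [`|_|]/Num.norm /= mx_normrE; apply/bigmax_ltP; split=> //.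
  move=> [i j] _ /=; rewrite ord1 !mxE distrC.
  by have := h j I; rewrite /= -ball_normE.
apply: fin_bigcap_measurable => // i _.
rewrite -[X in measurable X]setTI; apply: mY => //.
exact: measurable_ball.
Qed.

(** Measurability is known for the coordinates only. The open set [U] is the union of countably many
    cubes with rational centre and radius 1/(n+1), and each cube is a finite intersection of
    coordinate conditions. As [T] is arbitrary, this applies to sub-sigma-algebras too. *)
Lemma measurable_fun_continuous_rV Y G :
  (forall i, measurable_fun setT (fun w => Y w 0 i)) -> continuous G ->
  measurable_fun setT (G \o Y).
Proof.
move=> mY cG.
apply: (measurability (@RGenOInfty.G R) (RGenOInfty.measurableE R)).
move=> _ [_ [a ->] <-]; rewrite setTI.
pose U := G @^-1` `]a, +oo[%classic.
have oU : open U by move/continuousP : cG; apply; exact: interval_open.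
pose box (q : 'rV[rat]_d * nat) :=
  [set w | `|Y w - map_mx ratr q.1| < (q.2.+1%:R^-1 : R)].
pose ok (q : 'rV[rat]_d * nat) :=
  forall y, `|y - map_mx ratr q.1| < (q.2.+1%:R^-1 : R) -> U y.
rewrite (_ : (_ @^-1` _) = \bigcup_(q in [set: 'rV[rat]_d * nat])
    (if `[< ok q >] then box q else set0)).
  apply: countable_bigcupT_measurable => // q.
  by case: ifPn => // _; exact: measurable_fun_rV_norm_lt.
apply/seteqP; split=> [w Uw|w [q _]]; last first.
  by case: ifPn => // /asboolP okq bq; exact: okq.
have : nbhs (Y w) U by apply: open_nbhs_nbhs; split.
move=> /nbhs_normP[e /= e0 eU].
have [n nP] : exists n : nat, n.+1%:R^-1 < e / 2.
  have /filter_ex[n nP] := near_infty_natSinv_lt (PosNum (divr_gt0 e0 (ltr0Sn R 1))).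
  by exists n.
have /choice[q qP] (i : 'I_d) : exists q : rat, `|Y w 0 i - ratr q| < n.+1%:R^-1.
  have n0 : 0 < n.+1%:R^-1 :> R by rewrite invr_gt0.
  have [|z [/= h [q _ qz]]] := @dense_rat R (ball (Y w 0 i) n.+1%:R^-1) _ (ball_open _ _).
    by exists (Y w 0 i); exact: ballxx.
  by exists q; move: h; rewrite -qz -ball_normE.
have YQ : `|Y w - map_mx ratr (\row_i q i)| < n.+1%:R^-1.
  rewrite [`|_|]/Num.norm /= mx_normrE; apply/bigmax_ltP; split=> //.
  by move=> [i j] _ /=; rewrite ord1 !mxE.
exists (\row_i q i, n) => //.
case: ifPn => [_//|/asboolP[]] y /= yq; apply: eU => /=.
rewrite -(subrK (map_mx ratr (\row_i q i)) (Y w)) -addrA.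
rewrite (le_lt_trans (ler_normD _ _))// (splitr e) ltrD ?(lt_trans YQ)//.
by rewrite distrC (lt_trans yq).
Qed.

End measurable_coordinates.

(** * Integrals of bounded random variables *)

Section bounded_random_variables.
Context {R : realType} {disp : measure_display} {T : measurableType disp}
  (P : probability T R).
Implicit Types X Y : T -> R.

(** The algebra in which the truncated and localized integrands live: closed under sums and
    products, with integrability for free. *)
Definition bounded_rv X :=
  measurable_fun setT X /\ exists M, forall w, `|X w| <= M.

Lemma bounded_rv_integrable X : bounded_rv X -> P.-integrable setT (EFin \o X).
Proof.
move=> [mX [M XM]]; apply: measurable_bounded_integrable => //.
  exact: le_lt_trans (probability_le1 P measurableT) (ltry _).
by exists M; split; [exact: num_real|move=> r Mr w _; exact: le_trans (XM w) (ltW Mr)].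
Qed.

Lemma bounded_rv_cst c : bounded_rv (fun=> c).
Proof. by split; [exact: measurable_cst|exists `|c|]. Qed.

Lemma bounded_rvD X Y : bounded_rv X -> bounded_rv Y -> bounded_rv (fun w => X w + Y w).
Proof.
move=> [mX [M XM]] [mY [N YN]]; split; first exact: measurable_funD.
by exists (M + N) => w; rewrite (le_trans (ler_normD _ _))// lerD.
Qed.

Lemma bounded_rvM X Y : bounded_rv X -> bounded_rv Y -> bounded_rv (fun w => X w * Y w).
Proof.
move=> [mX [M XM]] [mY [N YN]]; split; first exact: measurable_funM.
by exists (M * N) => w; rewrite normrM ler_pM.
Qed.

Lemma bounded_rv_sum (I : Type) (r : seq I) (X : I -> T -> R) :
  (forall i, bounded_rv (X i)) -> bounded_rv (fun w => \sum_(i <- r) X i w).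
Proof.
move=> bX; elim: r => [|i r IH].
  by under eq_fun do rewrite big_nil; exact: bounded_rv_cst.
by under eq_fun do rewrite big_cons; exact: bounded_rvD.
Qed.

Lemma bounded_rv_indic (A : set T) : measurable A -> bounded_rv (\1_A : T -> R).
Proof.
move=> mA; split; first exact: measurable_indic.
by exists 1 => w; rewrite indicE; case: (_ \in _); rewrite ?normr1 ?normr0.
Qed.

Lemma Rintegral_rvD X Y : bounded_rv X -> bounded_rv Y ->
  \int[P]_w (X w + Y w) = \int[P]_w X w + \int[P]_w Y w.
Proof. by move=> bX bY; rewrite RintegralD//; exact: bounded_rv_integrable. Qed.

Lemma Rintegral_rvZ c X : bounded_rv X -> \int[P]_w (c * X w) = c * \int[P]_w X w.
Proof. by move=> bX; rewrite RintegralZl//; exact: bounded_rv_integrable. Qed.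

Lemma Rintegral_rv_sum (I : Type) (r : seq I) (X : I -> T -> R) :
  (forall i, bounded_rv (X i)) ->
  \int[P]_w (\sum_(i <- r) X i w) = \sum_(i <- r) \int[P]_w X i w.
Proof.
move=> bX; elim: r => [|i r IH].
  under eq_Rintegral do rewrite big_nil.
  by rewrite Rintegral_cst// mul0r big_nil.
under eq_Rintegral do rewrite big_cons.
by rewrite Rintegral_rvD ?IH ?big_cons//; exact: bounded_rv_sum.
Qed.

Lemma le_Rintegral_rv X Y : bounded_rv X -> bounded_rv Y ->
  (forall w, X w <= Y w) -> \int[P]_w X w <= \int[P]_w Y w.
Proof. by move=> bX bY XY; apply: le_Rintegral => //; exact: bounded_rv_integrable. Qed.

(** Independence says that the law of (X, Y) and the product of the marginal laws agree on
    rectangles, hence everywhere; Fubini then splits the integral of the product. *)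
Lemma Rintegral_indep_mul X Y : bounded_rv X -> bounded_rv Y ->
  (forall A B, measurable A -> measurable B ->
    P (X @^-1` A `&` Y @^-1` B) = (P (X @^-1` A) * P (Y @^-1` B))%E) ->
  \int[P]_w (X w * Y w) = (\int[P]_w X w) * \int[P]_w Y w.
Proof.
move=> bX bY XY.
have iX := bounded_rv_integrable _ bX; have iY := bounded_rv_integrable _ bY.
have iXY := bounded_rv_integrable _ (bounded_rvM _ _ bX bY).
have [mX _] := bX; have [mY _] := bY.
pose X' : {mfun T >-> R} := HB.pack X (isMeasurableFun.Build _ _ _ _ X mX).
pose Y' : {mfun T >-> R} := HB.pack Y (isMeasurableFun.Build _ _ _ _ Y mY).
pose Z w := (X w, Y w).
have mZ : measurable_fun setT Z by exact: measurable_fun_pair.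
pose Z' : {mfun T >-> (R * R)%type} := HB.pack Z (isMeasurableFun.Build _ _ _ _ Z mZ).
pose f (z : R * R) := (z.1 * z.2)%:E.
have mf : measurable_fun setT f.
  by apply/measurable_EFinP; apply: measurable_funM.
have E12 g : (\int[distribution P Z']_z g z =
    \int[distribution P X' \x distribution P Y']_z g z)%E.
  apply: eq_measure_integral => A mA _; apply/esym.
  by apply: product_measure_unique => // C D mC mD; exact: XY.
have iZ : (distribution P Z').-integrable setT f by exact: integrable_pushforward.
have iXYp : (distribution P X' \x distribution P Y')%E.-integrable setT f.
  by case/integrableP: iZ => _; rewrite E12 => h; apply/integrableP; split.
have iX' : (distribution P X').-integrable setT EFin by exact: integrable_pushforward.
have iY' : (distribution P Y').-integrable setT EFin by exact: integrable_pushforward.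
have EX : (\int[distribution P X']_x x%:E = \int[P]_w (X w)%:E)%E by rewrite integral_distribution.
have EY : (\int[distribution P Y']_x x%:E = \int[P]_w (Y w)%:E)%E by rewrite integral_distribution.
rewrite /Rintegral -fineM; [|exact: integrable_fin_num..].
congr fine.
transitivity (\int[distribution P Z']_z f z)%E; first by rewrite integral_distribution.
rewrite E12 -integral12_prod_meas1//.
have fY : (\int[P]_w (Y w)%:E)%E \is a fin_num by exact: integrable_fin_num.
transitivity (\int[distribution P X']_x (x%:E * (\int[P]_w (Y w)%:E)))%E.
  by apply: eq_integral => x _; rewrite -EY -integralZl.
by rewrite -(fineK fY) integralZr// EX.
Qed.

End bounded_random_variables.

(** * Truncated Gaussian moments *)

Section normal_moments.
Context {R : realType}.
Local Notation mu := (@lebesgue_measure R).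

Lemma Rintegral_FTC2 (F f : R -> R) (a b : R) : a < b ->
  (forall x : R, is_derive x 1 F (f x)) -> continuous f ->
  \int[mu]_(x in `[a, b]) f x = F b - F a.
Proof.
move=> ab dF cf.
have cF : continuous F.
  by move=> x; apply/differentiable_continuous/derivable1_diffP.
rewrite /Rintegral (@continuous_FTC2 _ _ F)//.
- exact: continuous_subspaceT.
- split=> [x _|//|].
  + by [].
  + exact: cvg_at_right_filter (cF a).
  + exact: cvg_at_left_filter (cF b).
- by move=> x _; rewrite derive1E derive_val.
Qed.

(** The Radon-Nikodym derivative of the normal law coincides almost everywhere with [normal_pdf],
    both having the same integral over every measurable set. *)
Lemma integral_normal_prob (m s : R) (f : R -> \bar R) :
  (normal_prob m s).-integrable setT f ->
  (\int[normal_prob m s]_x f x = \int[mu]_x (f x * (normal_pdf m s x)%:E))%E.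
Proof.
move=> intf.
have dom := normal_prob_dominates m s.
rewrite -(Radon_Nikodym_change_of_variables dom)//.
have mf := measurable_int _ intf.
have mpdf : measurable_fun setT (fun x => (normal_pdf m s x)%:E).
  by apply/measurable_EFinP; exact: measurable_normal_pdf.
apply: ae_eq_integral => //; [exact: emeasurable_funM|exact: emeasurable_funM|].
have H : ae_eq mu setT (Radon_Nikodym (charge_of_finite_measure (normal_prob m s)) mu)
    (fun x => (normal_pdf m s x)%:E).
  apply: integral_ae_eq => //.
  - by apply: Radon_Nikodym_integrable; exact: dom.
  - by move=> E _ mE; rewrite -Radon_Nikodym_integral.
exact: ae_eqe_mul2l H.
Qed.

(** Large values are sent to 0 instead of being clipped to the endpoints; thus, when g vanishes at
    0, the mean of g after truncation is an integral over [-rho, rho] only. *)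
Definition truncate (rho u : R) : R := u * \1_`[- rho, rho] u.

Lemma truncate_id rho u : `|u| <= rho -> truncate rho u = u.
Proof.
by move=> h; rewrite /truncate indicE mem_set ?mulr1//= in_itv/= -ler_norml.
Qed.

Lemma truncate_le rho u : 0 <= rho -> `|truncate rho u| <= rho.
Proof.
rewrite /truncate indicE => r0; have [|] := boolP (u \in _).
  by rewrite inE/= in_itv/= -ler_norml mulr1.
by rewrite mulr0 normr0.
Qed.

Lemma measurable_truncate rho : measurable_fun setT (truncate rho).
Proof. by apply: measurable_funM => //; exact: measurable_indic. Qed.

Lemma is_derive_normal_pdf (s x : R) : s != 0 ->
  is_derive x 1 (normal_pdf 0 s) (- (x / s ^+ 2) * normal_pdf 0 s x).
Proof.
move=> s0.
have E u : normal_pdf 0 s u = normal_peak s * expR (- (2 * s ^+ 2)^-1 * u ^+ 2).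
  rewrite normal_pdfE//; congr (_ * expR _).
  by rewrite subr0 mulNr mulrC mulNr -mulr_natl.
rewrite E (_ : normal_pdf 0 s = fun u =>
  normal_peak s * expR (- (2 * s ^+ 2)^-1 * u ^+ 2)); last exact/funext.
apply: is_derive_eq; rewrite /GRing.scale/= mulr1; field.
by rewrite s0.
Qed.

Section centered_normal.
Variable s : R.
Hypothesis s_gt0 : 0 < s.
Let s0 : s != 0 := lt0r_neq0 s_gt0.
Local Notation phi := (normal_pdf 0 s).

Let trunc_integral (g : R -> R) (rho : R) : 0 < rho -> continuous g -> g 0 = 0 ->
  \int[normal_prob 0 s]_u g (truncate rho u) = \int[mu]_(u in `[- rho, rho]) (g u * phi u).
Proof.
move=> rho0 cg g0.
have [M M0 MP] : exists2 M, 0 < M & forall u, `|g (truncate rho u)| <= M.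
  have /compact_bounded[M [Mr MP]] := continuous_compact
    (continuous_subspaceT cg) (@segment_compact R (- rho) rho).
  exists (`|M| + 1) => [|u]; first by rewrite ltr_wpDl.
  apply: (MP (`|M| + 1)); first by rewrite (le_lt_trans (ler_norm _))// ltrDl.
  exists (truncate rho u) => //=.
  by rewrite in_itv/= -ler_norml truncate_le// ltW.
have mg : measurable_fun setT (fun u => g (truncate rho u)).
  apply: measurableT_comp; last exact: measurable_truncate.
  exact: continuous_measurable_fun.
have bg : bounded_rv (fun u => g (truncate rho u)) by split=> //; exists M.
rewrite /Rintegral integral_normal_prob; last exact: bounded_rv_integrable.
congr fine; rewrite [RHS]integral_mkcond; apply: eq_integral => u _.
rewrite patchE; case: ifPn => [|ui].
  by rewrite inE/= in_itv/= -ler_norml => ur; rewrite truncate_id.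
by rewrite /truncate indicE (negbTE ui) mulr0 g0 mul0e.
Qed.

Lemma normal_truncate_mean rho : 0 < rho ->
  \int[normal_prob 0 s]_u truncate rho u = 0.
Proof.
move=> rho0; rewrite (trunc_integral id)//; last by move=> ?; exact: cvg_id.
(* Since phi' = - (x / s^2) phi, this is an antiderivative of x phi; it is even, so its increment
   over the symmetric interval vanishes. *)
have dF (x : R) : is_derive x 1 (fun u => - s ^+ 2 * phi u) (x * phi x).
  have h := is_derive_normal_pdf s x s0.
  by apply: is_derive_eq; rewrite /GRing.scale/=; field.
rewrite (Rintegral_FTC2 _ _ _ _ _ dF).
- by rewrite normal_pdfE// /normal_fun !subr0 sqrrN subrr.
- by rewrite gtrN.
- by move=> x; apply: cvgM; [exact: cvg_id|exact: continuous_normal_pdf].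
Qed.

(** Integration by parts: s^2 phi - u^2 phi is the derivative of s^2 u phi, whose increment over
    [-rho, rho] is nonnegative, and phi has mass at most 1 there. *)
Lemma normal_truncate_var_le rho : 0 < rho ->
  \int[normal_prob 0 s]_u truncate rho u ^+ 2 <= s ^+ 2.
Proof.
move=> rho0; rewrite (trunc_integral (fun u => u ^+ 2)) ?expr0n//; last exact: sqr_continuous.
have cphi : continuous phi by exact: continuous_normal_pdf.
have c2 : continuous (fun u : R => u ^+ 2 * phi u).
  by move=> x; apply: cvgM; [exact: sqr_continuous|exact: cphi].
have ic (f : R -> R) : continuous f -> mu.-integrable `[- rho, rho] (EFin \o f).
  move=> cf; apply: continuous_compact_integrable; first exact: segment_compact.
  exact: continuous_subspaceT.
have : \int[mu]_(u in `[- rho, rho]) (s ^+ 2 * phi u - u ^+ 2 * phi u) =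
    s ^+ 2 * rho * phi rho - s ^+ 2 * (- rho) * phi (- rho).
  have dF (x : R) : is_derive x 1 (fun u => s ^+ 2 * u * phi u)
      (s ^+ 2 * phi x - x ^+ 2 * phi x).
    have h := is_derive_normal_pdf s x s0.
    by apply: is_derive_eq; rewrite /GRing.scale/=; field.
  rewrite (Rintegral_FTC2 _ _ _ _ _ dF)//.
  - by rewrite gtrN.
  - move=> x; apply: cvgB; [|exact: c2].
    by apply: cvgM; [exact: cvg_cst|exact: cphi].
have cs : continuous (fun u => s ^+ 2 * phi u).
  by move=> x; apply: cvgM; [exact: cvg_cst|exact: cphi].
rewrite RintegralB//; [|exact: ic|exact: ic].
rewrite RintegralZl//; last exact: ic.
have : \int[mu]_(u in `[- rho, rho]) phi u <= 1.
  have : (\int[mu]_(u in `[(- rho)%R, rho]) (phi u)%:E <= \int[mu]_u (phi u)%:E)%E.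
    apply: ge0_subset_integral => //.
      by apply/measurable_EFinP; exact: measurable_normal_pdf.
    by move=> u _; rewrite lee_fin normal_pdf_ge0.
  rewrite integral_normal_pdf /Rintegral => h.
  by rewrite -lee_fin fineK//; apply: integrable_fin_num => //; exact: ic.
set I := \int[mu]_(u in `[- rho, rho]) phi u => I1 E.
have v0 := sqr_ge0 s.
have h1 : s ^+ 2 * I <= s ^+ 2 by rewrite ler_piMr.
have h2 : 0 <= s ^+ 2 * rho * phi rho.
  by rewrite !mulr_ge0 ?normal_pdf_ge0// ltW.
have h3 : 0 <= s ^+ 2 * rho * phi (- rho).
  by rewrite !mulr_ge0 ?normal_pdf_ge0// ltW.
by move: E h3; rewrite mulrN mulNr; lra.
Qed.

End centered_normal.

End normal_moments.

Section gaussian_vector.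
Context {R : realType} {d : nat} {disp : measure_display} {T : measurableType disp}
  (P : probability T R) (Y : T -> 'rV[R]_d) (v : R).
Hypotheses (mY : forall i, measurable_fun setT (fun w => Y w 0 i))
  (gY : centered_gaussian P Y v) (v_gt0 : 0 < v).
Local Notation nu := (normal_prob (0 : R) (Num.sqrt v)).

Lemma gaussian_coord_law i A : measurable A ->
  P ((fun w => Y w 0 i) @^-1` A) = nu A.
Proof.
move=> mA; pose A' k := if k == i then A else setT.
have := gY A'; rewrite (bigD1 i)//= /A' eqxx big1 ?mule1 => [<-|k /negbTE ->].
- congr (P _); apply/seteqP; split=> w /=.
    by move=> h k; case: eqP => // ->.
  by move=> /(_ i); rewrite eqxx.
- by move=> k; case: ifP.
- by rewrite probability_setT.
Qed.

Lemma gaussian_coord_indep i j A B : i != j -> measurable A -> measurable B ->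
  P ((fun w => Y w 0 i) @^-1` A `&` (fun w => Y w 0 j) @^-1` B) =
  (P ((fun w => Y w 0%R i) @^-1` A) * P ((fun w => Y w 0%R j) @^-1` B))%E.
Proof.
move=> ij mA mB; rewrite !gaussian_coord_law//.
pose A' k := if k == i then A else if k == j then B else setT.
have := gY A'; rewrite (bigD1 i)//= (bigD1 j) 1?eq_sym//= /A' eqxx.
rewrite (negbTE (_ : j != i)) 1?eq_sym// eqxx big1 ?mule1 => [<-|k /andP[/negbTE -> /negbTE ->]].
- congr (P _); apply/seteqP; split=> w /=.
    by move=> [h1 h2] k; case: eqP => [->//|_]; case: eqP => // ->.
  move=> h; split; first by have := h i; rewrite eqxx.
  by have := h j; rewrite eq_sym (negbTE ij) eqxx.
- by move=> k; case: ifP => // _; case: ifP.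
- by rewrite probability_setT.
Qed.

Lemma gaussian_coord_integral i f : bounded_rv f ->
  \int[P]_w f (Y w 0 i) = \int[nu]_u f u.
Proof.
move=> bf; have [mf [M fM]] := bf.
(* [normal_prob] lives on [measurableTypeR R], whose display differs from the
   default one of [R]. *)
pose Yi : {mfun T >-> measurableTypeR R} := HB.pack (fun w => Y w 0 i : measurableTypeR R)
  (isMeasurableFun.Build _ _ _ _ (fun w => Y w 0 i : measurableTypeR R) (mY i)).
have bfY : bounded_rv (fun w => f (Y w 0 i)).
  by split; [exact: (measurableT_comp mf (mY i))|exists M].
rewrite /Rintegral; congr fine.
transitivity (\int[distribution P Yi]_u (f u)%:E)%E.
  rewrite integral_distribution//; first exact/measurable_EFinP.
  exact: bounded_rv_integrable bfY.
have law A : measurable A -> A `<=` setT -> distribution P Yi A = nu A.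
  by move=> mA _; exact: gaussian_coord_law.
exact: (@eq_measure_integral _ _ _ _ _ _ _ law).
Qed.

Lemma bounded_truncate_coord rho i : 0 < rho ->
  bounded_rv (fun w => truncate rho (Y w 0 i)).
Proof.
move=> rho0; split; first exact: (measurableT_comp (measurable_truncate rho) (mY i)).
by exists rho => w; rewrite truncate_le// ltW.
Qed.

Lemma gaussian_truncate_mean rho i : 0 < rho ->
  \int[P]_w truncate rho (Y w 0 i) = 0.
Proof.
move=> rho0; rewrite gaussian_coord_integral ?normal_truncate_mean// ?sqrtr_gt0//.
by split; [exact: measurable_truncate|exists rho => u; rewrite truncate_le// ltW].
Qed.

(** The coordinates stay independent, centred and equally distributed after truncation, so the
    covariance is a multiple [m] of the identity. The bound [m <= v] is enough because [m] will
    multiply an integral bounded above by the nonnegative [l2]. *)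
Lemma gaussian_truncate_covariance rho : 0 < rho ->
  exists2 m, 0 <= m <= v & forall i j,
    \int[P]_w (truncate rho (Y w 0 i) * truncate rho (Y w 0 j)) =
    if i == j then m else 0.
Proof.
move=> rho0; exists (\int[nu]_u truncate rho u ^+ 2).
  rewrite Rintegral_ge0/= => [|u _]; last exact: sqr_ge0.
  by rewrite -[leRHS](sqr_sqrtr (ltW v_gt0)) normal_truncate_var_le// sqrtr_gt0.
have btr : bounded_rv (truncate rho : R -> R).
  by split; [exact: measurable_truncate|exists rho => u; rewrite truncate_le// ltW].
move=> i j; case: eqVneq => [<-|ij].
  rewrite -(gaussian_coord_integral i (fun u => truncate rho u ^+ 2))//.
  exact: bounded_rvM.
rewrite Rintegral_indep_mul ?gaussian_truncate_mean ?mul0r//;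
  [exact: bounded_truncate_coord|exact: bounded_truncate_coord|].
move=> A B mA mB.
have mtr C : measurable C -> measurable (truncate rho @^-1` C).
  by move=> mC; rewrite -[X in measurable X]setTI; exact: measurable_truncate.
exact: (gaussian_coord_indep i j _ _ ij (mtr _ mA) (mtr _ mB)).
Qed.

End gaussian_vector.

(** * Measurability with respect to a sub-sigma-algebra *)

Section sub_sigma_algebra.
Context {R : realType} {disp : measure_display} {T : measurableType disp}.

(** The type [g_sigma_algebraType G] equips [T] with the sigma-algebra generated by [G], which is
    [G] itself when [G] is one; general measurability lemmas then apply to [G]. *)
Definition measurable_wrt (G : set (set T)) (f : T -> R) :=
  @measurable_fun _ _ (g_sigma_algebraType G) R setT f.

Lemma measurable_wrt_preimage G f A : sigma_algebra setT G ->
  measurable_wrt G f -> measurable A -> G (f @^-1` A).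
Proof.
move=> sG mf mA; have := mf measurableT A mA; rewrite setTI.
by rewrite /measurable/= sigma_algebra_id.
Qed.

Lemma measurable_wrt_measurable G f : sigma_algebra setT G -> G `<=` measurable ->
  measurable_wrt G f -> measurable_fun setT f.
Proof.
by move=> sG Gm mf _ A mA; rewrite setTI; apply: Gm; exact: measurable_wrt_preimage.
Qed.

Lemma sigma_of_measurable_wrt {d} G (Y : T -> 'rV[R]_d) i :
  sigma_of Y `<=` G -> measurable_wrt G (fun w => Y w 0 i).
Proof.
move=> YG _ A mA; rewrite setTI; apply: sub_sigma_algebra; apply: YG.
apply: sub_sigma_algebra; rewrite (bigD1 i)//=; left.
by exists A; rewrite ?setTI.
Qed.

Lemma sigma_of_measurable {d} (Y : T -> 'rV[R]_d) :
  (forall i, measurable_fun setT (fun w => Y w 0 i)) -> sigma_of Y `<=` measurable.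
Proof.
move=> mY; apply: smallest_sub; first exact: sigma_algebra_measurable.
apply: (big_ind (fun S => S `<=` measurable)) => [//|U V mU mV|i _]; first by rewrite subUset.
by move=> _ [A mA <-]; exact: mY.
Qed.

Lemma indep_classes_Rintegral (P : probability T R) G H X Y :
  sigma_algebra setT G -> sigma_algebra setT H -> G `<=` measurable -> H `<=` measurable ->
  indep_classes P G H -> measurable_wrt G X -> measurable_wrt H Y ->
  (exists M, forall w, `|X w| <= M) -> (exists M, forall w, `|Y w| <= M) ->
  \int[P]_w (X w * Y w) = (\int[P]_w X w) * \int[P]_w Y w.
Proof.
move=> sG sH Gm Hm GH mX mY bX bY.
apply: Rintegral_indep_mul.
- by split => //; exact: measurable_wrt_measurable mX.
- by split => //; exact: measurable_wrt_measurable mY.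
- by move=> A B mA mB; apply: GH; exact: measurable_wrt_preimage.
Qed.

End sub_sigma_algebra.

(** * One Euler step *)

Section localized_composition.
Context {R : realType} {d : nat} {disp : measure_display} {T : measurableType disp}.
Variables (G : set (set T)) (A : set T) (X : T -> 'rV[R]_d) (r : R).
Hypotheses (sG : sigma_algebra setT G) (Gm : G `<=` measurable) (GA : G A)
  (mX : forall i, measurable_wrt G (fun w => X w 0 i))
  (Xr : forall w, A w -> `|X w| <= r).

Lemma measurable_wrt_localized (f : 'rV[R]_d -> R) : continuous f ->
  measurable_wrt G (fun w => \1_A w * f (X w)).
Proof.
move=> cf; apply: measurable_funM.
  by apply: measurable_indic; rewrite /measurable/= sigma_algebra_id.
exact: (@measurable_fun_continuous_rV R d _ (g_sigma_algebraType G) X f mX cf).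
Qed.

Lemma localized_bounded (f : 'rV[R]_d -> R) : continuous f ->
  exists M, forall w, `|\1_A w * f (X w)| <= M.
Proof.
move=> cf; have [M M0 MP] := continuous_bounded_rV_ball f r cf.
exists M => w; rewrite indicE; have [|] := boolP (w \in A).
  by rewrite inE => Aw; rewrite mul1r MP// Xr.
by rewrite mul0r normr0 ltW.
Qed.

Lemma bounded_rv_localized (f : 'rV[R]_d -> R) : continuous f ->
  bounded_rv (fun w => \1_A w * f (X w)).
Proof.
move=> cf; split; last exact: localized_bounded.
exact: measurable_wrt_measurable (measurable_wrt_localized _ cf).
Qed.

End localized_composition.

Definition truncate_rV {R : realType} {d : nat} (rho : R) (v : 'rV[R]_d) : 'rV[R]_d :=
  \row_i truncate rho (v 0 i).

Section noise_step.
Context {R : realType} {d : nat}.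
Variables (L : 'rV[R]_d -> R) (m l2 sigma : R).
Hypotheses (hC2 : C2 L) (hlap : forall x, laplacian L x <= l2) (l2_ge0 : 0 <= l2)
  (sigma_gt0 : 0 < sigma).

(** Expand L to second order at [X] and integrate. As [xi] is independent of [G], each term factors:
    the first-order ones vanish with the mean, the mixed ones with the covariance, and the diagonal
    ones give sigma times the Laplacian times a variance at most h. The radius [rho] is chosen
    before the probability space and the step h. *)
Lemma noise_step (r e : R) : 0 < e -> exists2 rho, 0 < rho &
  forall (disp : measure_display) (T : measurableType disp) (P : probability T R)
    (G : set (set T)) (A : set T) (X xi : T -> 'rV[R]_d) (h : R),
  sigma_algebra setT G -> G `<=` measurable -> G A ->
  (forall i, measurable_wrt G (fun w => X w 0 i)) ->
  (forall i, measurable_fun setT (fun w => xi w 0 i)) ->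
  indep_classes P G (sigma_of xi) -> 0 < h -> centered_gaussian P xi h ->
  (forall w, A w -> `|X w| <= r) ->
  bounded_rv (fun w => \1_A w * (L (X w + Num.sqrt (2 * sigma) *: truncate_rV rho (xi w)) - m)) /\
  \int[P]_w (\1_A w * (L (X w + Num.sqrt (2 * sigma) *: truncate_rV rho (xi w)) - m)) <=
  \int[P]_w (\1_A w * (L (X w) - m)) + h * (sigma * l2 + e).
Proof.
set c := Num.sqrt (2 * sigma); move=> e0; have [cL _ cdL _ cddL] := hC2.
have c2 : c ^+ 2 = 2 * sigma by rewrite sqr_sqrtr// mulr_ge0// ltW.
have c0 : 0 < c by rewrite sqrtr_gt0 mulr_gt0.
have k0 : 0 < 1 + 2 * sigma * d%:R.
  by rewrite ltr_pwDl// !mulr_ge0// ltW.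
(* The remainder has mean at most 2 sigma d e2 h, which this choice keeps below h e. *)
pose e2 := e / (1 + 2 * sigma * d%:R).
have e20 : 0 < e2 by exact: divr_gt0.
have [rho2 rho20 expan] := C2_expansion L r e2 hC2 e20.
exists (rho2 / c) => [|disp T P G A X xi h sG Gm GA mX mxi ind h0 gxi Xr].
  exact: divr_gt0.
(* The noise is scaled by [c], so truncation at rho2 / c keeps the displacement within rho2, where
   the expansion is valid. *)
set rho := rho2 / c; have rho0 : 0 < rho by exact: divr_gt0.
pose z i w := truncate rho (xi w 0 i).
have mA := Gm _ GA.
have loc (f : 'rV[R]_d -> R) : continuous f -> bounded_rv (fun w => \1_A w * f (X w)).
  exact: (bounded_rv_localized G A X r).
have cLm : continuous (fun x => L x - m).
  by move=> x; apply: (cvgB (cL x)); exact: cvg_cst.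
have bz i : bounded_rv (z i) by exact: bounded_truncate_coord.
have mz i : measurable_wrt (sigma_of xi) (z i).
  apply: (@measurableT_comp _ _ _ (g_sigma_algebraType (sigma_of xi)) R R).
    exact: measurable_truncate.
  exact: sigma_of_measurable_wrt.
have mzz i j : measurable_wrt (sigma_of xi) (fun w => z i w * z j w).
  by apply: measurable_funM; exact: mz.
have [mv /andP[mv0 mvh] cov] := gaussian_truncate_covariance P xi h mxi gxi h0 rho rho0.
have ssx : sigma_algebra setT (sigma_of xi) by exact: smallest_sigma_algebra.
have sxm := sigma_of_measurable xi mxi.
have Ef (f : 'rV[R]_d -> R) Y : continuous f -> measurable_wrt (sigma_of xi) Y -> bounded_rv Y ->
    \int[P]_w (\1_A w * f (X w) * Y w) = (\int[P]_w (\1_A w * f (X w))) * \int[P]_w Y w.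
  move=> cf mY [_ bY].
  apply: (indep_classes_Rintegral P G (sigma_of xi)) => //.
    exact: measurable_wrt_localized.
  exact: (localized_bounded A X r).
(* The last sum carries no indicator: it is nonnegative, so [rhs] still dominates off [A], where the
   other terms vanish. *)
pose rhs w := \1_A w * (L (X w) - m)
   + \sum_i c * (\1_A w * pderiv i L (X w) * z i w)
   + \sum_i \sum_j sigma * (\1_A w * pderiv j (pderiv i L) (X w) * (z i w * z j w))
   + \sum_i (2 * sigma * e2) * (z i w * z i w).
pose ev := \int[P]_w (\1_A w * (L (X w) - m)).
have zle w : `|c *: truncate_rV rho (xi w)| <= rho2.
  rewrite normrZ (gtr0_norm c0) mulrC -ler_pdivlMr//.
  apply/rV_norm_le => [|i]; first exact: ltW.
  by rewrite mxE truncate_le// ltW.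
have le_rhs w : \1_A w * (L (X w + c *: truncate_rV rho (xi w)) - m) <= rhs w.
  rewrite /rhs indicE; have [|] := boolP (w \in A); last first.
    rewrite !mul0r add0r !addr_ge0//; apply: sumr_ge0 => i _.
    - by rewrite !mul0r mulr0.
    - by apply: sumr_ge0 => j _; rewrite !mul0r mulr0.
    - by rewrite -expr2 mulr_ge0 ?sqr_ge0// mulr_ge0 ?(ltW e20)// mulr_ge0// ltW.
  rewrite inE => Aw; rewrite mul1r.
  have q1 : \sum_i (c *: truncate_rV rho (xi w)) 0 i * pderiv i L (X w) =
      \sum_i c * (true%:R * pderiv i L (X w) * z i w).
    by apply: eq_bigr => i _; rewrite !mxE mul1r -mulrA (mulrC (z i w)).
  have q2 : 2^-1 * (\sum_i \sum_j (c *: truncate_rV rho (xi w)) 0 i *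
      (c *: truncate_rV rho (xi w)) 0 j * pderiv j (pderiv i L) (X w)) =
      \sum_i \sum_j sigma * (true%:R * pderiv j (pderiv i L) (X w) * (z i w * z j w)).
    rewrite mulr_sumr; apply: eq_bigr => i _; rewrite mulr_sumr; apply: eq_bigr => j _.
    rewrite !mxE mul1r -/(z i w) -/(z j w).
    rewrite -[X in _ = X * _](mulKf (_ : 2 != 0))// -c2; ring.
  have q3 : e2 * (\sum_i (c *: truncate_rV rho (xi w)) 0 i ^+ 2) =
      \sum_i 2 * sigma * e2 * (z i w * z i w).
    rewrite mulr_sumr; apply: eq_bigr => i _; rewrite !mxE -/(z i w) -c2; ring.
  have := expan _ _ (Xr _ Aw) (zle w); rewrite q1 q2 q3 mul1r; lra.
have b1 i : bounded_rv (fun w => \1_A w * pderiv i L (X w) * z i w).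
  by apply: bounded_rvM => //; exact: loc.
have b2 i j : bounded_rv (fun w => \1_A w * pderiv j (pderiv i L) (X w) * (z i w * z j w)).
  by apply: bounded_rvM; [exact: loc|exact: bounded_rvM].
have bZ (k : R) (Y : T -> R) : bounded_rv Y -> bounded_rv (fun w => k * Y w).
  by move=> bY; apply: bounded_rvM => //; exact: bounded_rv_cst.
have b3 i : bounded_rv (fun w => z i w * z i w) by exact: bounded_rvM.
have s1 := bounded_rv_sum _ (index_enum 'I_d) _ (fun i => bZ c _ (b1 i)).
have s2i i := bounded_rv_sum _ (index_enum 'I_d) _ (fun j => bZ sigma _ (b2 i j)).
have s2 := bounded_rv_sum _ (index_enum 'I_d) _ s2i.
have s3 := bounded_rv_sum _ (index_enum 'I_d) _ (fun i => bZ (2 * sigma * e2) _ (b3 i)).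
have b0 := loc _ cLm.
have b01 := bounded_rvD _ _ b0 s1.
have b012 := bounded_rvD _ _ b01 s2.
have brhs : bounded_rv rhs := bounded_rvD _ _ b012 s3.
have b4 : bounded_rv (fun w => \1_A w * (L (X w + c *: truncate_rV rho (xi w)) - m)).
  have [M M0 MP] := continuous_bounded_rV_ball _ (r + rho2) cLm.
  split; last first.
    exists M => w; rewrite indicE; have [|] := boolP (w \in A).
      rewrite inE => Aw; rewrite mul1r MP// (le_trans (ler_normD _ _))// lerD//.
      exact: Xr.
    by rewrite mul0r normr0 ltW.
  apply: measurable_funM; first exact: measurable_indic.
  apply: (measurable_fun_continuous_rV (fun w => X w + c *: truncate_rV rho (xi w))
    (fun x => L x - m)) => // i.
  under eq_fun do rewrite !mxE.
  apply: measurable_funD; first exact: measurable_wrt_measurable (mX i).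
  by apply: measurable_funM => //; exact: (bz i).1.
split=> //.
apply: (le_trans (le_Rintegral_rv _ _ _ b4 brhs le_rhs)).
have -> : \int[P]_w rhs w = ev + \sum_i \int[P]_w (c * (\1_A w * pderiv i L (X w) * z i w))
   + \sum_i \sum_j \int[P]_w (sigma * (\1_A w * pderiv j (pderiv i L) (X w) * (z i w * z j w)))
   + \sum_i \int[P]_w ((2 * sigma * e2) * (z i w * z i w)).
  rewrite (Rintegral_rvD P _ _ b012 s3) (Rintegral_rvD P _ _ b01 s2) (Rintegral_rvD P _ _ b0 s1).
  rewrite (Rintegral_rv_sum P _ _ _ (fun i => bZ c _ (b1 i))).
  rewrite (Rintegral_rv_sum P _ _ _ s2i).
  rewrite (Rintegral_rv_sum P _ _ _ (fun i => bZ (2 * sigma * e2) _ (b3 i))).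
  congr (_ + _ + _); apply: eq_bigr => i _.
  by rewrite (Rintegral_rv_sum P _ _ _ (fun j => bZ sigma _ (b2 i j))).
rewrite [X in _ + X + _ + _]big1 ?addr0 => [|i _]; last first.
  rewrite (Rintegral_rvZ _ _ _ (b1 i)) Ef//.
  by rewrite (gaussian_truncate_mean P xi h)// !mulr0.
have -> : \sum_i \sum_j \int[P]_w (sigma * (\1_A w * pderiv j (pderiv i L) (X w) * (z i w * z j w)))
    = sigma * (mv * \int[P]_w (\1_A w * laplacian L (X w))).
  under [in RHS]eq_Rintegral do rewrite /laplacian mulr_sumr.
  rewrite (Rintegral_rv_sum P _ _ _ (fun i => loc _ (cddL i i))) mulr_sumr mulr_sumr.
  apply: eq_bigr => i _; rewrite (bigD1 i)//= big1 ?addr0 => [|j ji].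
    rewrite (Rintegral_rvZ _ _ _ (b2 i i)) Ef//.
    by rewrite cov eqxx (mulrC mv).
  rewrite (Rintegral_rvZ _ _ _ (b2 i j)) Ef//; last exact: bounded_rvM.
  by rewrite cov eq_sym (negbTE ji) !mulr0.
have -> : \sum_i \int[P]_w (2 * sigma * e2 * (z i w * z i w)) = 2 * sigma * d%:R * e2 * mv.
  under eq_bigr do rewrite (Rintegral_rvZ _ _ _ (b3 _)) cov eqxx.
  by rewrite sumr_const card_ord -mulr_natr; ring.
have lap1 : \int[P]_w (\1_A w * laplacian L (X w)) <= l2.
  have -> : l2 = \int[P]_w l2 :> R.
    by rewrite Rintegral_cst//= [X in fine X](probability_setT P) mulr1.
  apply: le_Rintegral_rv; [|exact: bounded_rv_cst|].
    under eq_fun do rewrite /laplacian mulr_sumr.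
    by apply: bounded_rv_sum => i; exact: loc.
  by move=> w; rewrite indicE; case: (_ \in _); rewrite ?mul1r ?mul0r.
rewrite -addrA lerD2l mulrDr lerD//.
  rewrite [leRHS]mulrCA ler_wpM2l ?(ltW sigma_gt0)//.
  by rewrite (@le_trans _ _ (mv * l2)) ?ler_wpM2l ?ler_wpM2r.
rewrite mulrC ler_pM//.
  by rewrite mulr_ge0 ?(ltW e20)// !mulr_ge0// ltW.
by rewrite /e2 mulrA ler_pdivrMr// mulrC ler_wpM2l ?(ltW e0)// lerDr.
Qed.

End noise_step.

Lemma truncate_rV_id {R : realType} {d : nat} (rho : R) (v : 'rV[R]_d) :
  `|v| <= rho -> truncate_rV rho v = v.
Proof.
move=> h; apply/rowP => i; rewrite mxE truncate_id//.
exact: le_trans (rV_coord_le _ _) h.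
Qed.

Lemma Rintegral_rv_addc {R : realType} {disp : measure_display}
    {T : measurableType disp} (P : probability T R) (X : T -> R) k :
  bounded_rv X -> \int[P]_w (X w + k) = \int[P]_w X w + k.
Proof.
move=> bX; rewrite (Rintegral_rvD P _ _ bX (bounded_rv_cst k)); congr (_ + _).
by rewrite Rintegral_cst//= [X in fine X](probability_setT P) mulr1.
Qed.

Section euler_step.
Context {R : realType} {d : nat}.
Variables (L : 'rV[R]_d -> R) (m l1 l2 sigma : R).
Hypotheses (hC2 : C2 L) (l1_gt0 : 0 < l1) (l2_ge0 : 0 <= l2) (sigma_gt0 : 0 < sigma)
  (hm : forall x, m <= L x)
  (hPL : forall x, l1 * (L x - m) <= \sum_i pderiv i L x ^+ 2)
  (hlap : forall x, laplacian L x <= l2).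

Lemma grad_bounded r : exists2 M, 0 < M & forall x, `|x| <= r -> `|grad L x| <= M.
Proof.
have [_ _ cdL _ _] := hC2.
have /choice[M MP] i : exists M, 0 < M /\ forall x, `|x| <= r -> `|pderiv i L x| <= M.
  by have [M M0 MP] := continuous_bounded_rV_ball _ r (cdL i); exists M.
have S0 : 0 <= \sum_i M i by apply: sumr_ge0 => i _; rewrite ltW// (MP i).1.
exists (1 + \sum_i M i) => [|x xr]; first by rewrite ltr_pwDl.
apply/rV_norm_le => [|i]; first by rewrite addr_ge0.
rewrite mxE (le_trans ((MP i).2 x xr))// (bigD1 i)//= addrCA lerDl addr_ge0//.
by apply: sumr_ge0 => j _; rewrite ltW// (MP j).1.
Qed.

(** A gradient step lowers L by h |grad L|^2 up to an error h e, and the PL inequality turns this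
    decrease into l1 h (L - m). *)
Lemma drift_step r e : 0 < e -> exists2 h0, 0 < h0 & forall h x, 0 < h -> h <= h0 ->
  `|x| <= r -> [/\ `|x - h *: grad L x| <= r + 1, 0 <= 1 - l1 * h &
    L (x - h *: grad L x) - m <= (1 - l1 * h) * (L x - m) + h * e].
Proof.
move=> e0; have [_ dL cdL _ _] := hC2.
have [M M0 MP] := grad_bounded r.
have [rho rho0 expan] := C1_expansion L r (e / M) dL cdL (divr_gt0 e0 M0).
(* The three bounds on h serve in turn to keep the step within the range of the expansion, to keep
   it at most 1, and to make 1 - l1 h nonnegative. *)
exists (Num.min (rho / M) (Num.min (M^-1) l1^-1)).
  by rewrite !lt_min divr_gt0// !invr_gt0 M0.
move=> h x h0; rewrite !le_min => /and3P[h1 h2 h3] xr.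
have gM := MP _ xr.
have hg : `|h *: grad L x| <= h * M by rewrite normrZ gtr0_norm// ler_wpM2l// ltW.
have hM1 : h * M <= 1 by rewrite -ler_pdivlMr// div1r.
have hMr : h * M <= rho by rewrite -ler_pdivlMr.
split.
- by rewrite (le_trans (ler_normB _ _))// lerD// (le_trans hg).
- by rewrite subr_ge0 -ler_pdivlMl// mulr1.
have := expan x (- (h *: grad L x)) xr; rewrite normrN => /(_ (le_trans hg hMr)).
have -> : \sum_i (- (h *: grad L x)) 0 i * pderiv i L x = - (h * \sum_i pderiv i L x ^+ 2).
  rewrite mulr_sumr -sumrN; apply: eq_bigr => i _; rewrite !mxE; ring.
have eM : e / M * `|h *: grad L x| <= h * e.
  rewrite -mulrA [leRHS]mulrC ler_wpM2l ?(ltW e0)// ler_pdivrMl// mulrC.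
  by rewrite (le_trans hg)// mulrC.
have := ler_wpM2l (ltW h0) (hPL x).
by lra.
Qed.

(** A drift step followed by a noise step, each with error e/3; the last third pays for replacing
    the Euler point by [W], through the Lipschitz bound. The noise acts on points already moved by
    the drift, hence the radius r + 1. *)
Lemma euler_step r e : 0 < e -> exists rho eta h0, [/\ 0 < rho, 0 < eta, 0 < h0 &
  forall (disp : measure_display) (T : measurableType disp) (P : probability T R)
    (G : set (set T)) (A A' : set T) (X W xi : T -> 'rV[R]_d) (h : R),
  sigma_algebra setT G -> G `<=` measurable -> G A -> measurable A' -> A' `<=` A ->
  (forall i, measurable_wrt G (fun w => X w 0 i)) ->
  (forall i, measurable_fun setT (fun w => W w 0 i)) ->
  (forall i, measurable_fun setT (fun w => xi w 0 i)) ->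
  indep_classes P G (sigma_of xi) -> 0 < h -> h <= h0 -> centered_gaussian P xi h ->
  (forall w, A w -> `|X w| <= r) ->
  (forall w, A' w -> [/\ `|W w| <= r, `|xi w| <= rho &
     `|W w - (X w - h *: grad L (X w) + Num.sqrt (2 * sigma) *: xi w)| <= h * eta]) ->
  \int[P]_w (\1_A' w * (L (W w) - m)) <=
  (1 - l1 * h) * \int[P]_w (\1_A w * (L (X w) - m)) + h * (sigma * l2 + e)].
Proof.
move=> e0; have [cL dL cdL _ _] := hC2.
have e3 : 0 < e / 3 by rewrite divr_gt0.
have [rho rho0 noise] := noise_step L m l2 sigma hC2 hlap l2_ge0 sigma_gt0 (r + 1) (e / 3) e3.
have [M M0 lip] := C1_lipschitz L (r + 1) dL cdL.
have [h0 h00 drift] := drift_step r (e / 3) e3.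
(* With this [eta] the Lipschitz bound costs M h eta = h e / 3. The second bound on h gives h eta <=
   1, so the Euler point lies in the ball of radius r + 1. *)
exists rho, (e / 3 / M), (Num.min h0 (e / 3 / M)^-1).
have eM0 : 0 < e / 3 / M by rewrite divr_gt0.
split=> //; first by rewrite lt_min h00 invr_gt0.
move=> disp T P G A A' X W xi h sG Gm GA mA' A'A mX mW mxi ind h_gt0.
rewrite le_min => /andP[hh0 heta] gxi Xr A'P.
set c := Num.sqrt (2 * sigma).
pose x w := X w - h *: grad L (X w).
have cLm : continuous (fun x => L x - m).
  by move=> y; apply: (cvgB (cL y)); exact: cvg_cst.
have mA := Gm _ GA.
have mx i : measurable_wrt G (fun w => x w 0 i).
  rewrite /measurable_wrt /x; under eq_fun do rewrite !mxE.
  apply: measurable_funB; first exact: mX.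
  apply: measurable_funM => //.
  exact: (@measurable_fun_continuous_rV R d _ (g_sigma_algebraType G) X _ mX (cdL i)).
have xr w : A w -> `|x w| <= r + 1 by move=> Aw; have [] := drift h (X w) h_gt0 hh0 (Xr w Aw).
have [b2 H] := noise disp T P G A x xi h sG Gm GA mx mxi ind h_gt0 gxi xr.
have b1 : bounded_rv (fun w => \1_A' w * (L (W w) - m)).
  have [N N0 NP] := continuous_bounded_rV_ball _ r cLm.
  split; last first.
    exists N => w; rewrite indicE; have [|] := boolP (w \in A').
      by rewrite inE => /A'P[Wr _ _]; rewrite mul1r NP.
    by rewrite mul0r normr0 ltW.
  apply: measurable_funM; first exact: measurable_indic.
  exact: (measurable_fun_continuous_rV W _ mW cLm).
have b3 : bounded_rv (fun w => \1_A w * (L (X w) - m)).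
  exact: (bounded_rv_localized G A X r sG Gm GA mX Xr _ cLm).
have b4 : bounded_rv (fun w => \1_A w * (L (x w) - m)).
  exact: (bounded_rv_localized G A x (r + 1) sG Gm GA mx xr _ cLm).
have bc (k : R) : bounded_rv (fun=> k : R) (T := T) := bounded_rv_cst k.
(* On A' nothing is truncated; off A' the right-hand side is nonnegative. *)
have I1 : \int[P]_w (\1_A' w * (L (W w) - m)) <=
    \int[P]_w (\1_A w * (L (x w + c *: truncate_rV rho (xi w)) - m)) + h * (e / 3).
  rewrite -(Rintegral_rv_addc P _ _ b2).
  apply: le_Rintegral_rv; [exact: b1|exact: bounded_rvD|].
  move=> w; rewrite !indicE; have [|_] := boolP (w \in A'); last first.
    rewrite mul0r addr_ge0//; last by rewrite ltW// mulr_gt0.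
    by rewrite mulr_ge0// subr_ge0.
  rewrite inE => A'w; have [Wr xir Wy] := A'P w A'w.
  rewrite mem_set ?mul1r; last exact: A'A.
  rewrite truncate_rV_id// -/(x w) in Wy *.
  rewrite addrAC lerD2r.
  have heta1 : h * (e / 3 / M) <= 1 by rewrite -ler_pdivlMr// div1r.
  have yr : `|x w + c *: xi w| <= r + 1.
    rewrite -[x w + _](subKr (W w)) (le_trans (ler_normB _ _))//.
    by rewrite lerD// (le_trans Wy).
  have Wr1 : `|W w| <= r + 1 by rewrite (le_trans Wr)// lerDl.
  rewrite (le_trans (lip _ _ yr Wr1))// lerD2l.
  by rewrite -ler_pdivlMl// mulrC -mulrA.
have I2 : \int[P]_w (\1_A w * (L (x w) - m)) <=
    (1 - l1 * h) * \int[P]_w (\1_A w * (L (X w) - m)) + h * (e / 3).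
  rewrite -(Rintegral_rvZ P _ _ b3).
  have b5 := bounded_rvM _ _ (bc (1 - l1 * h)) b3.
  rewrite -(Rintegral_rv_addc P _ _ b5).
  apply: le_Rintegral_rv; [exact: b4|exact: bounded_rvD|].
  move=> w; rewrite !indicE; have [|_] := boolP (w \in A); last first.
    by rewrite !mul0r mulr0 add0r ltW// mulr_gt0.
  by rewrite inE => Aw; rewrite !mul1r; have [] := drift h (X w) h_gt0 hh0 (Xr w Aw).
lra.
Qed.

End euler_step.

(** * Good events *)

Lemma norm_le_event {R : realType} {d : nat} {disp : measure_display}
    {T : measurableType disp} (G : set (set T)) (V : T -> 'rV[R]_d) (a : R) :
  sigma_algebra setT G -> (forall i, measurable_wrt G (fun w => V w 0 i)) ->
  G [set w | `|V w| <= a].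
Proof.
move=> sG mV.
have mn : measurable_wrt G (fun w => `|V w|).
  exact: (@measurable_fun_continuous_rV R d _ (g_sigma_algebraType G) V _ mV
    (@norm_continuous _ _)).
have := measurable_wrt_preimage G _ `]-oo, a]%classic sG mn (measurable_itv _).
by congr (G _); apply/seteqP; split=> w /=; rewrite in_itv.
Qed.

Section good_events.
Context {R : realType} {d : nat} {disp : measure_display} {Omega : measurableType disp}.
Variables (P : probability Omega R) (F : R -> set (set Omega))
  (B w : R -> Omega -> 'rV[R]_d) (L : 'rV[R]_d -> R) (sigma : R).
Hypotheses (hC2 : C2 L) (hF : is_filtration F) (hB : brownian_motion P F B)
  (aw : adapted F w).

Definition euler_defect (s t : R) omega : 'rV[R]_d :=
  w t omega - (w s omega - (t - s) *: grad L (w s omega)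
    + Num.sqrt (2 * sigma) *: (B t omega - B s omega)).

Variables (r rho eta h : R).

Definition good_step (s t : R) : set Omega :=
  [set omega | `|w t omega| <= r /\ (`|B t omega - B s omega| <= rho /\
    `|euler_defect s t omega| <= (t - s) * eta)].

(** By recursion the events decrease in k and involve times up to kh only. The base case is written
    with [0%:R * h] to fit the uniform form [k%:R * h]. *)
Fixpoint good (k : nat) : set Omega :=
  if k is k'.+1 then good k' `&` good_step (k'%:R * h) (k'.+1%:R * h)
  else [set omega | `|w (0%:R * h) omega| <= r].

Lemma adapted_measurable_wrt (X : R -> Omega -> 'rV[R]_d) (s t : R) i :
  adapted F X -> 0 <= s -> s <= t -> measurable_wrt (F t) (fun o => X s o 0 i).
Proof.
move=> aX s0 st; apply: sigma_of_measurable_wrt => A sA.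
by apply: (filtration_mono hF s0 st); exact: aX.
Qed.

(** Adaptedness of the events is what makes their indicators independent of the next Brownian
    increment. *)
Lemma good_measurable (k : nat) : 0 <= h -> F (k%:R * h) (good k).
Proof.
move=> h0; have kh (n : nat) : 0 <= n%:R * h by rewrite mulr_ge0.
have sF n := filtration_sigma hF (kh n).
elim: k => [|k IH] /=.
  apply: norm_le_event => // i; exact: adapted_measurable_wrt.
set s := k%:R * h; set t := k.+1%:R * h.
have s0 : 0 <= s by exact: kh.
have st : s <= t by rewrite ler_wpM2r// ler_nat.
have t0 : 0 <= t by exact: kh.
have mw i := adapted_measurable_wrt w s t i aw s0 st.
have mwt i := adapted_measurable_wrt w t t i aw t0 (lexx t).
have mB i := adapted_measurable_wrt B s t i (bm_adapted hB) s0 st.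
have mBt i := adapted_measurable_wrt B t t i (bm_adapted hB) t0 (lexx t).
have [_ _ cdL _ _] := hC2.
have I : setI_closed (F t).
  by have [] := (sigma_algebraP (fun X _ => @subsetT _ X)).1 (sF k.+1).
have mdB i : measurable_wrt (F t) (fun o => (B t o - B s o) 0 i).
  by rewrite /measurable_wrt; under eq_fun do rewrite !mxE; apply: measurable_funB;
    [exact: mBt|exact: mB].
apply: (I); first exact: (filtration_mono hF s0 st).
apply: (I); first exact: (norm_le_event _ _ _ (sF k.+1) mwt).
apply: (I); first exact: (norm_le_event _ _ _ (sF k.+1) mdB).
apply: (norm_le_event _ _ _ (sF k.+1)) => i.
rewrite /measurable_wrt /euler_defect; under eq_fun do rewrite !mxE.
apply: measurable_funB; first exact: mwt.
apply: measurable_funD.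
  apply: measurable_funB; first exact: mw.
  apply: measurable_funM => //.
  exact: (@measurable_fun_continuous_rV R d _ (g_sigma_algebraType (F t)) (w s) _ mw (cdL i)).
apply: measurable_funM => //.
by apply: measurable_funB; [exact: mBt|exact: mB].
Qed.

Lemma good_norm_le k omega : good k omega -> `|w (k%:R * h) omega| <= r.
Proof. by case: k => [//|k] [_ []]. Qed.
End good_events.

(** * Discrete Gronwall inequality *)

Section discrete_gronwall.
Context {R : realType}.

(** Compare one step with the exponential flow: 1 - l1 h <= u, where u = exp(-l1 h), and the source
    h D is at most (1 + e) D (1 - u) / l1. The stated bound solves the resulting recursion
    exactly. *)
Lemma discrete_gronwall (a : nat -> R) (l1 h D e : R) : 0 < l1 -> 0 < h -> 0 <= D ->
  l1 * h <= e -> (forall k, 0 <= a k) ->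
  (forall k, a k.+1 <= (1 - l1 * h) * a k + h * D) ->
  forall k, a k <= expR (- (l1 * (k%:R * h))) * a 0%N
    + D * (1 + e) * ((1 - expR (- (l1 * (k%:R * h)))) / l1).
Proof.
move=> l10 h0 D0 he a0 aS.
have lh0 : 0 < l1 * h by exact: mulr_gt0.
set u := expR (- (l1 * h)).
have uE k : expR (- (l1 * (k%:R * h))) = u ^+ k.
  by rewrite -expRM_natl; congr expR; rewrite mulrN mulrCA.
(* From u (1 + l1 h) <= 1 one gets l1 h <= (1 + l1 h) (1 - u), and l1 h <= e. *)
have hu : h <= (1 + e) * ((1 - u) / l1).
  rewrite mulrA ler_pdivlMr// mulrC.
  have u1 : u * (1 + l1 * h) <= 1.
    rewrite /u expRN ler_pdivrMl ?expR_gt0// mulr1; exact: expR_ge1Dx.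
  have u0 : u <= 1 by rewrite /u -expR0 ler_expR oppr_le0 ltW.
  have : (1 + l1 * h) * (1 - u) <= (1 + e) * (1 - u).
    by rewrite ler_wpM2r ?subr_ge0// lerD2l.
  lra.
elim=> [|k IH]; rewrite uE.
  by rewrite expr0 mul1r subrr mul0r mulr0 addr0.
rewrite uE in IH.
have h1 : (1 - l1 * h) * a k <= u * a k.
  by rewrite ler_wpM2r//; exact: expR_ge1Dx.
have h2 : u * a k <= u * (u ^+ k * a 0%N + D * (1 + e) * ((1 - u ^+ k) / l1)).
  by rewrite ler_wpM2l// expR_ge0.
have h3 := ler_wpM2r D0 hu.
apply: (le_trans (aS k)); apply: (le_trans (lerD (le_trans h1 h2) h3)).
rewrite exprS le_eqVlt; apply/orP; left; apply/eqP; field.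
exact: lt0r_neq0.
Qed.

End discrete_gronwall.

Section good_expectation.
Context {R : realType} {d : nat} {disp : measure_display} {Omega : measurableType disp}.
Variables (P : probability Omega R) (F : R -> set (set Omega))
  (B w : R -> Omega -> 'rV[R]_d) (L : 'rV[R]_d -> R) (m l1 l2 sigma : R).
Hypotheses (hC2 : C2 L) (hF : is_filtration F) (hB : brownian_motion P F B)
  (aw : adapted F w) (w0 : {ae P, forall omega, w 0 omega = 0})
  (l1_gt0 : 0 < l1) (l2_ge0 : 0 <= l2) (sigma_gt0 : 0 < sigma)
  (hm : forall x, m <= L x)
  (hPL : forall x, l1 * (L x - m) <= \sum_i pderiv i L x ^+ 2)
  (hlap : forall x, laplacian L x <= l2).

Lemma adapted_measurable (X : R -> Omega -> 'rV[R]_d) t i : adapted F X -> 0 <= t ->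
  measurable_fun setT (fun o => X t o 0 i).
Proof.
move=> aX t0; apply: (measurable_wrt_measurable (F t)).
- exact: (filtration_sigma hF t0).
- exact: (filtration_sub hF t0).
- exact: (adapted_measurable_wrt F).
Qed.

Lemma gap_measurable t : 0 <= t -> measurable_fun setT (fun o => L (w t o) - m).
Proof.
move=> t0; have [cL _ _ _ _] := hC2.
apply: (measurable_fun_continuous_rV (w t) (fun x => L x - m)).
  by move=> i; exact: adapted_measurable.
by move=> y; apply: (cvgB (cL y)); exact: cvg_cst.
Qed.

(** [euler_step] on each of the N cells of [0, t] feeds the Gronwall recursion; at time 0 the start
    at the origin gives the value L(0) - m, reduced at most by the indicator. *)
Lemma good_expectation r e t : 0 < e -> 0 < t ->
  exists rho eta N0, [/\ 0 < rho, 0 < eta & forall N, (N0 <= N)%N ->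
    measurable (good B w L sigma r rho eta (t / N%:R) N) /\
    (\int[P]_omega
      (\1_(good B w L sigma r rho eta (t / N%:R) N) omega * (L (w t omega) - m))%:E
    <= (expR (- l1 * t) * (L 0 - m)
      + (sigma * l2 + e) * (1 + e) * ((1 - expR (- l1 * t)) / l1))%:E)%E].
Proof.
move=> e0 t0.
have [rho [eta [h0 [rho0 eta0 h00 step]]]] :=
  euler_step L m l1 l2 sigma hC2 l1_gt0 l2_ge0 sigma_gt0 hm hPL hlap r e e0.
(* The first bound is the one of [euler_step], the second gives l1 h <= e for the Gronwall
   argument. *)
pose hmax := Num.min h0 (e / l1).
have hmax0 : 0 < hmax by rewrite lt_min h00 divr_gt0.
exists rho, eta, (Num.truncn (t / hmax)).+1; split=> // N NN.
have N0 : 0 < N%:R :> R by rewrite ltr0n (leq_trans _ NN).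
set h := t / N%:R.
have hgt0 : 0 < h by exact: divr_gt0.
have hle : h <= hmax.
  rewrite ler_pdivrMr// mulrC -ler_pdivrMr//.
  by rewrite (le_trans (ltW (truncnS_gt _)))// ler_nat.
have [hh0 hl1] : h <= h0 /\ l1 * h <= e.
  move: hle; rewrite le_min => /andP[-> hl]; split=> //.
  by rewrite mulrC -ler_pdivlMr.
pose A k := good B w L sigma r rho eta h k.
pose a k := \int[P]_omega (\1_(A k) omega * (L (w (k%:R * h) omega) - m)).
have kh (n : nat) : 0 <= n%:R * h by rewrite mulr_ge0// ltW.
have FA k : F (k%:R * h) (A k).
  exact: (good_measurable P F B w L sigma hC2 hF hB aw r rho eta h k (ltW hgt0)).
have mA k : measurable (A k) by exact: (filtration_sub hF (kh k) (FA k)).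
have a0 k : 0 <= a k.
  by apply: Rintegral_ge0 => o _; rewrite mulr_ge0 ?subr_ge0.
have aS k : a k.+1 <= (1 - l1 * h) * a k + h * (sigma * l2 + e).
  have ts : k.+1%:R * h - k%:R * h = h by rewrite -mulrBl -natrB// subSnn mul1r.
  have st : k%:R * h < k.+1%:R * h by rewrite -subr_gt0 ts.
  apply: (step _ _ P (F (k%:R * h)) (A k) (A k.+1) (w (k%:R * h)) (w (k.+1%:R * h))
    (fun o => B (k.+1%:R * h) o - B (k%:R * h) o)) => //.
  - exact: (filtration_sigma hF (kh k)).
  - exact: (filtration_sub hF (kh k)).
  - by move=> o [].
  - by move=> i; exact: (adapted_measurable_wrt F).
  - by move=> i; exact: adapted_measurable.
  - move=> i; under eq_fun do rewrite !mxE.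
    by apply: measurable_funB; apply: adapted_measurable => //; exact: (bm_adapted hB).
  - exact: (bm_indep hB (kh k) st).
  - by have := bm_gaussian hB (kh k) st; rewrite ts.
  - by move=> o; exact: good_norm_le.
  - move=> o [_ [h1 [h2]]]; rewrite /euler_defect ts => h3.
    by split.
have D0 : 0 <= sigma * l2 + e by rewrite addr_ge0 ?mulr_ge0// ltW.
split; first exact: mA.
have NhE : N%:R * h = t by rewrite /h mulrC divfK// lt0r_neq0.
have bg : bounded_rv (fun o => \1_(A N) o * (L (w t o) - m)).
  have [cL _ _ _ _] := hC2.
  apply: (bounded_rv_localized (F t) (A N) (w t) r _ _ _ _ _ (fun x => L x - m)).
  - exact: (filtration_sigma hF (ltW t0)).
  - exact: (filtration_sub hF (ltW t0)).
  - by rewrite -NhE; exact: FA.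
  - by move=> i; apply: (adapted_measurable_wrt F) => //; exact: ltW.
  - by move=> o /good_norm_le; rewrite NhE.
  - by move=> y; apply: (cvgB (cL y)); exact: cvg_cst.
rewrite -[leLHS]fineK; last first.
  by apply: integrable_fin_num => //; exact: (bounded_rv_integrable P _ bg).
rewrite lee_fin.
have := discrete_gronwall a l1 h (sigma * l2 + e) e l1_gt0 hgt0 D0 hl1 a0 aS N.
rewrite {1}/a NhE -mulNr => /le_trans; apply; rewrite lerD2r ler_wpM2l ?expR_ge0//.
rewrite /a mul0r.
have -> : \int[P]_omega (\1_(A 0%N) omega * (L (w 0 omega) - m)) =
    \int[P]_omega (\1_(A 0%N) omega * (L 0 - m)).
  rewrite /Rintegral; congr fine; apply: ae_eq_integral => //.
  - apply/measurable_EFinP; apply: measurable_funM; first exact: measurable_indic.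
    exact: gap_measurable.
  - by apply/measurable_EFinP; apply: measurable_funM => //; exact: measurable_indic.
  - by apply: filterS w0 => o ->.
have -> : L 0 - m = \int[P]_omega (L 0 - m).
  by rewrite Rintegral_cst//= [X in fine X](probability_setT P) mulr1.
apply: le_Rintegral_rv; last 2 first.
- exact: bounded_rv_cst.
- move=> o; rewrite Rintegral_cst//= [X in fine X](probability_setT P) mulr1 indicE.
  by case: (_ \in _); rewrite ?mul1r ?mul0r ?subr_ge0.
by apply: bounded_rvM; [exact: bounded_rv_indic|exact: bounded_rv_cst].
Qed.

End good_expectation.

(** * Continuous paths lie in the good events of fine meshes *)

Section paths.
Context {R : realType} {d : nat}.
Local Notation mu := (@lebesgue_measure R).

(** Error of the left rectangle rule on [s, t]. The integral is written as a difference of integrals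
    from 0, the form in which the integral equation supplies it. *)
Lemma Rintegral_itvB_dist (p : R -> R) (s t e : R) : 0 <= s -> s <= t ->
  {within `[0, t], continuous p} -> (forall u, s <= u -> u <= t -> `|p s - p u| <= e) ->
  `|(t - s) * p s - (\int[mu]_(u in `[0, t]) p u - \int[mu]_(u in `[0, s]) p u)|
  <= (t - s) * e.
Proof.
move=> s0 st cp pe.
have ip : mu.-integrable `[0, t] (EFin \o p).
  by apply: continuous_compact_integrable => //; exact: segment_compact.
have ss : `[s, t]%classic `<=` `[0, t]%classic.
  by move=> u /=; rewrite !in_itv/= => /andP[su ->]; rewrite (le_trans s0 su).
have ip' : mu.-integrable `[s, t] (EFin \o p) by apply: integrableS ip.
have ms : mu `[s, t]%classic = (t - s)%:E.
  by rewrite lebesgue_measure_itv/= lte_fin; case: ltP => // ts;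
    rewrite (@le_anti _ _ s t) ?subrr// st.
have ic (k : R) : mu.-integrable `[s, t] (EFin \o (fun=> k)).
  by apply: continuous_compact_integrable; [exact: segment_compact|exact: cst_continuous].
rewrite Rintegral_itvB ?bnd_simp//.
have -> : \int[mu]_(x in `]s, t]) p x = \int[mu]_(x in `[s, t]) p x.
  rewrite Rintegral_itv_obnd_cbnd//; apply: integrableS ip' => //.
  exact: subset_itv_oc_cc.
have -> : (t - s) * p s = \int[mu]_(u in `[s, t]) p s.
  by rewrite Rintegral_cst// [X in fine X]ms mulrC.
rewrite -RintegralB//.
have ipd : mu.-integrable `[s, t] (EFin \o (fun u => p s - p u)).
  apply: continuous_compact_integrable; first exact: segment_compact.
  have cps := continuous_subspaceW ss cp.
  by move=> u; apply: cvgB; [exact: cvg_cst|exact: (cps u)].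
rewrite (le_trans (le_normr_Rintegral _ ipd))//.
have -> : (t - s) * e = \int[mu]_(u in `[s, t]) e.
  by rewrite Rintegral_cst// [X in fine X]ms mulrC.
apply: le_Rintegral => //.
  exact: integrable_norm.
by move=> u /=; rewrite in_itv/= => /andP[su ut]; exact: pe.
Qed.

(** Uniform continuity of the path of B on [0, t] bounds its increments by [rho]; that of w,
    combined with that of the gradient on the ball, makes the drift vary by at most [eta] over a
    cell. *)
Lemma path_good {disp : measure_display} {Omega : measurableType disp}
    (B w : R -> Omega -> 'rV[R]_d) (L : 'rV[R]_d -> R) (sigma : R) omega (r t rho eta : R) :
  C2 L ->
  {within `[0, +oo[, continuous (fun u => w u omega)} ->
  {within `[0, +oo[, continuous (fun u => B u omega)} ->
  (forall u, 0 <= u -> forall i : 'I_d, w u omega 0 i = w 0 omega 0 i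
      - (\int[mu]_(s in `[0, u]) grad L (w s omega) 0 i)
      + Num.sqrt (2 * sigma) * B u omega 0 i) ->
  0 < t -> (forall u, 0 <= u -> u <= t -> `|w u omega| <= r) -> 0 < rho -> 0 < eta ->
  exists N0, forall N, (N0 <= N)%N -> good B w L sigma r rho eta (t / N%:R) N omega.
Proof.
move=> hC2 cw cB eqn t0 wr rho0 eta0; have [_ _ cdL _ _] := hC2.
have [rho' rho'0 unifL] := unif_continuous_family _ (fun i => pderiv i L) r eta cdL eta0.
have sub : (`[0, t]%classic : set R) `<=` `[0, +oo[%classic.
  by move=> u /=; rewrite !in_itv/= => /andP[->].
have [d1 d10 unifB] := @compact_unif_continuous R R 'rV[R]_d _ _ _ rho
  (@segment_compact R 0 t) sub cB rho0.
have [d2 d20 unifw] := @compact_unif_continuous R R 'rV[R]_d _ _ _ rho'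
  (@segment_compact R 0 t) sub cw rho'0.
pose dl := Num.min d1 d2; have dl0 : 0 < dl by rewrite lt_min d10.
exists (Num.truncn (t / dl)).+1 => N NN.
have N0 : 0 < N%:R :> R by rewrite ltr0n (leq_trans _ NN).
set h := t / N%:R.
have h0 : 0 < h by exact: divr_gt0.
have hdl : h < dl.
  rewrite ltr_pdivrMr// mulrC -ltr_pdivrMr//.
  by rewrite (lt_le_trans (truncnS_gt _))// ler_nat.
have [hd1 hd2] : h < d1 /\ h < d2 by move: hdl; rewrite lt_min => /andP.
have kh k : 0 <= k%:R * h by rewrite mulr_ge0// ltW.
have kt k : (k <= N)%N -> k%:R * h <= t.
  move=> kN; rewrite /h mulrCA ger_pMr// ler_pdivrMr// mul1r ler_nat//.
suff : forall k, (k <= N)%N -> good B w L sigma r rho eta h k omega by exact.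
elim=> [_|k IH kN] /=; first by apply: wr; [exact: kh|exact: kt].
have kN' : (k <= N)%N by exact: ltnW.
split; first exact: IH.
set s := k%:R * h; set v := k.+1%:R * h.
have vs : v - s = h by rewrite /v /s -mulrBl -natrB// subSnn mul1r.
have sv : s < v by rewrite -subr_gt0 vs.
have s0 : 0 <= s by exact: kh.
have vt : v <= t by exact: kt.
have v0 : 0 <= v by exact: kh.
split; first exact: wr.
split.
  rewrite distrC ltW// unifB//=; rewrite ?in_itv/= ?s0 ?v0 ?(le_trans (ltW sv))//.
  by rewrite distrC vs gtr0_norm.
apply/rV_norm_le => [|i]; first by rewrite vs ltW// mulr_gt0.
pose p u := pderiv i L (w u omega).
have cp : {within `[0, v], continuous p}.
  have sub2 : (`[0, v]%classic : set R) `<=` `[0, +oo[%classic.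
    by move=> u /=; rewrite !in_itv/= => /andP[->].
  have cwv := continuous_subspaceW sub2 cw.
  by move=> u; exact: (cvg_comp _ _ (cwv u) (cdL i _)).
have pe u : s <= u -> u <= v -> `|p s - p u| <= eta.
  move=> su uv; rewrite distrC /p.
  have -> : w u omega = w s omega + (w u omega - w s omega) by rewrite addrC subrK.
  apply: unifL; first by apply: wr => //; rewrite (le_trans (ltW sv)).
  rewrite distrC ltW// unifw//=; rewrite ?in_itv/= ?s0 ?(le_trans s0 su) ?(le_trans (ltW sv))//.
  rewrite distrC ger0_norm ?subr_ge0// (le_lt_trans _ hd2)//.
  by rewrite -vs lerD2r.
(* Subtracting the integral equations at [s] and [v] cancels the noise, so a coordinate of the
   defect is exactly the error of the rectangle rule. *)
have := Rintegral_itvB_dist p s v eta s0 (ltW sv) cp pe.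
congr (_ <= _); congr `|_|.
rewrite /euler_defect !mxE.
have E u : \int[mu]_(s in `[0, u]) p s = \int[mu]_(s in `[0, u]) grad L (w s omega) 0 i.
  by apply: eq_Rintegral => y _; rewrite mxE.
by rewrite !E (eqn v v0 i) (eqn s s0 i) /p vs; ring.
Qed.

End paths.

(** * Passage to the limit *)

Section fatou_bounds.
Context {R : realType}.
Local Open Scope ereal_scope.

Lemma limn_einf_le (u : (\bar R)^nat) c : (forall n, u n <= c) -> limn_einf u <= c.
Proof.
move=> uc; rewrite limn_einf_lim; apply: lime_le; first exact: is_cvg_einfs.
apply: nearW => n; apply: le_trans (uc n).
by apply: ereal_inf_lbound; exists n => /=.
Qed.

Lemma limn_einf_near_cst (u : (\bar R)^nat) l : (\forall n \near \oo, u n = l) ->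
  limn_einf u = l.
Proof.
move=> ul; apply: (cvg_limn_einf_sup _).1; apply: cvg_near_cst; exact: ul.
Qed.

Lemma measurable_fun_limn_einf {disp : measure_display} {T : measurableType disp}
    (f : (T -> \bar R)^nat) : (forall n, measurable_fun setT (f n)) ->
  measurable_fun setT (fun x => limn_einf (f ^~ x)).
Proof.
move=> mf; rewrite /limn_einf; apply: measurableT_comp => //.
by apply: measurable_fun_limn_esup => n; exact: measurableT_comp.
Qed.

Lemma fatou_le {disp : measure_display} {T : measurableType disp}
    (mu : {measure set T -> \bar R}) (f : (T -> \bar R)^nat) c :
  (forall n, measurable_fun setT (f n)) -> (forall n x, 0 <= f n x) ->
  (forall n, \int[mu]_x f n x <= c) -> \int[mu]_x limn_einf (f ^~ x) <= c.
Proof.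
move=> mf f0 fc; apply: (le_trans (fatou mu measurableT mf (fun n x _ => f0 n x))).
exact: limn_einf_le.
Qed.

Lemma limn_einf_ge0 (u : (\bar R)^nat) : (forall n, 0 <= u n) -> 0 <= limn_einf u.
Proof.
move=> u0; rewrite limn_einf_lim; apply: lime_ge; first exact: is_cvg_einfs.
by apply: nearW => n; apply: le_ereal_inf_tmp => _ [m _ <-].
Qed.

End fatou_bounds.

Section expected_gap.
Context {R : realType} {d : nat} {disp : measure_display} {Omega : measurableType disp}.
Variables (P : probability Omega R) (F : R -> set (set Omega))
  (B w : R -> Omega -> 'rV[R]_d) (L : 'rV[R]_d -> R) (m l1 l2 sigma : R).
Hypotheses (hC2 : C2 L) (hF : is_filtration F) (hB : brownian_motion P F B)
  (hw : langevin_solution P F B L sigma w)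
  (l1_gt0 : 0 < l1) (l2_ge0 : 0 <= l2) (sigma_gt0 : 0 < sigma)
  (hm : forall x, m <= L x)
  (hPL : forall x, l1 * (L x - m) <= \sum_i pderiv i L x ^+ 2)
  (hlap : forall x, laplacian L x <= l2).

Let gap_meas t : 0 <= t -> measurable_fun setT (fun o => (L (w t o) - m)%:E).
Proof.
move=> t0; apply/measurable_EFinP.
exact: (gap_measurable F w L m hC2 hF (langevin_adapted hw) t t0).
Qed.

(** Fatou is used twice, for the mesh at the fixed radius [n] and then for the radius; the
    parameters [par n] of the good events depend on [n]. *)
Let gap_le_eps t e : 0 < t -> 0 < e ->
  (\int[P]_o (L (w t o) - m)%:E <= (expR (- l1 * t) * (L 0 - m)
      + (sigma * l2 + e) * (1 + e) * ((1 - expR (- l1 * t)) / l1))%:E)%E.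
Proof.
move=> t0 e0; set c := (X in (_ <= X%:E)%E).
have aw := langevin_adapted hw.
have /choice[par parP] (n : nat) : exists p : R * R * nat, [/\ 0 < p.1.1, 0 < p.1.2 &
    forall N, (p.2 <= N)%N ->
      measurable (good B w L sigma n%:R p.1.1 p.1.2 (t / N%:R) N) /\
    (\int[P]_o (\1_(good B w L sigma n%:R p.1.1 p.1.2 (t / N%:R) N) o * (L (w t o) - m))%:E
      <= c%:E)%E].
  have [rho [eta [N0 H]]] := good_expectation P F B w L m l1 l2 sigma hC2 hF hB aw
    (langevin_start hw) l1_gt0 l2_ge0 sigma_gt0 hm hPL hlap n%:R e t e0 t0.
  by exists (rho, eta, N0).
(* Shifting the index by the threshold of [par n] makes the bound available for every [N]. *)
pose A n N := good B w L sigma n%:R (par n).1.1 (par n).1.2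
  (t / ((par n).2 + N)%N%:R) ((par n).2 + N).
pose f n N o := (\1_(A n N) o * (L (w t o) - m))%:E.
have gm := gap_meas t (ltW t0).
have mf n N : measurable_fun setT (f n N).
  have [_ _ /(_ _ (leq_addr N _))[mA _]] := parP n.
  apply/measurable_EFinP; apply: measurable_funM; first exact: measurable_indic.
  exact/measurable_EFinP.
have f0 n N o : (0 <= f n N o)%E.
  by rewrite lee_fin mulr_ge0 ?subr_ge0.
have fc n N : (\int[P]_o f n N o <= c%:E)%E.
  by have [_ _ /(_ _ (leq_addr N _))[_]] := parP n.
pose g n o := limn_einf (f n ^~ o).
have mg n : measurable_fun setT (g n) by exact: measurable_fun_limn_einf.
have g0 n o : (0 <= g n o)%E by exact: limn_einf_ge0.
have gc n : (\int[P]_o g n o <= c%:E)%E by exact: fatou_le.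
apply: (@le_trans _ _ (\int[P]_o limn_einf (g ^~ o))%E); last exact: fatou_le.
apply: ae_ge0_le_integral => //.
- by move=> o _; rewrite lee_fin subr_ge0.
- by move=> o _; exact: limn_einf_ge0.
- exact: measurable_fun_limn_einf.
have := langevin_eq hw; apply: filterS => o eqn _.
(* Both lower limits are of eventually constant sequences: once [n] exceeds the bound [M] of the
   path on [0, t], the indicators are 1 for all large [N]. *)
rewrite (@limn_einf_near_cst _ _ (L (w t o) - m)%:E)//.
have cw : {within `[0, +oo[, continuous (fun u => w u o)}.
  exact: (langevin_continuous hw).
have cB : {within `[0, +oo[, continuous (fun u => B u o)}.
  exact: (bm_continuous hB).
have sub : (`[0, t]%classic : set R) `<=` `[0, +oo[%classic.
  by move=> u /=; rewrite !in_itv/= => /andP[->].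
have [M MP] : exists M, forall u, 0 <= u -> u <= t -> `|w u o| <= M.
  have /compact_bounded[M [Mr MP]] := continuous_compact
    (continuous_subspaceW sub cw) (@segment_compact R 0 t).
  exists (`|M| + 1) => u u0 ut; apply: (MP (`|M| + 1)).
    by rewrite (le_lt_trans (ler_norm _))// ltrDl.
  by exists u => //=; rewrite in_itv/= u0.
exists (Num.truncn M).+1 => // n /= Mn.
have Mn' : M <= n%:R by rewrite (le_trans (ltW (truncnS_gt M)))// ler_nat.
have [rho0 eta0 _] := parP n.
have [N0 good0] := path_good B w L sigma o n%:R t (par n).1.1 (par n).1.2
  hC2 cw cB eqn t0 (fun u u0 ut => le_trans (MP u u0 ut) Mn') rho0 eta0.
apply: limn_einf_near_cst; exists N0 => // N /= NN.
rewrite /f indicE mem_set ?mul1r//; apply: good0.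
by rewrite (leq_trans NN)// leq_addl.
Qed.

Lemma expected_gap_le t : 0 <= t ->
  (\int[P]_o (L (w t o) - m)%:E <= ((L 0 - m) * expR (- l1 * t)
      + sigma * l2 * ((1 - expR (- l1 * t)) / l1))%:E)%E.
Proof.
(* Time 0 is treated apart, as the mesh t / N has to be positive. *)
rewrite le_eqVlt => /predU1P[<-|t0].
  rewrite mulr0 expR0 subrr mul0r mulr0 addr0 mulr1.
  rewrite (ae_eq_integral (cst (L 0 - m)%:E))//.
  - by rewrite integral_cst//= [X in (_ * X)%E](probability_setT P) mule1.
  - exact: gap_meas.
  - by have := langevin_start hw; apply: filterS => o ->.
apply/lee_addgt0Pr => eps eps0; rewrite -EFinD.
pose c := (1 - expR (- l1 * t)) / l1.
have c0 : 0 <= c.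
  by rewrite divr_ge0 ?(ltW l1_gt0)// subr_ge0 -expR0 ler_expR mulNr oppr_le0 ltW// mulr_gt0.
have S0 : 0 <= sigma * l2 by rewrite mulr_ge0// ltW.
have K0 : 0 < (sigma * l2 + 2) * c + 1.
  by rewrite ltr_wpDl// mulr_ge0// addr_ge0.
(* Since e <= 1, (S + e) (1 + e) exceeds S = sigma l2 by at most e (S + 2); the second bound makes
   this excess, multiplied by c, at most eps. *)
pose e := Num.min 1 (eps / ((sigma * l2 + 2) * c + 1)).
have e0 : 0 < e by rewrite lt_min ltr01 divr_gt0.
apply: (le_trans (gap_le_eps t e t0 e0)); rewrite lee_fin -/c.
have [e1 e2] : e <= 1 /\ e * ((sigma * l2 + 2) * c + 1) <= eps.
  by rewrite -ler_pdivlMr//; apply/andP; rewrite -le_min.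
rewrite mulrC -addrA lerD2l.
have h1 : e * e <= e by rewrite ler_piMl// ltW.
have h2 : (sigma * l2 + e) * (1 + e) <= sigma * l2 + e * (sigma * l2 + 2).
  by move: h1; lra.
have := ler_wpM2r c0 h2.
have : 0 <= e by exact: ltW.
by move: e2; lra.
Qed.

End expected_gap.

(* [D] need not be measurable; this spares a proof that [confined] is. *)
Lemma ge0_integral_subset_setT {R : realType} {disp : measure_display}
    {T : measurableType disp} (mu : {measure set T -> \bar R}) (D : set T)
    (f : T -> \bar R) : (forall x, 0 <= f x)%E ->
  (\int[mu]_(x in D) f x <= \int[mu]_x f x)%E.
Proof.
move=> f0; rewrite ge0_integralE// ge0_integralTE//.
apply: ereal_sup_le => _ [h /= hf <-]; exists h => //= x.
by apply: (le_trans (hf x)); rewrite patchE; case: ifP.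
Qed.

(** * The conditional bound, and the tail bound by Markov's inequality *)

Theorem proposition12 (R : realType) (d : nat)
  (L : 'rV[R]_d -> R) (Lstar l1 l2 r0 : R)
  (hC2 : C2 L) (hmin : is_minimum L Lstar)
  (hl1 : 0 < l1) (hl2 : 0 < l2) (hr0 : 0 < r0)
  (hPL : forall r : R, r0 <= r -> forall w, eball r w ->
    L w - Lstar <= 1 / l1 * enorm (grad L w) ^+ 2)
  (hlap : forall r : R, r0 <= r -> forall w, eball r w ->
    `|laplacian L w| <= l2)
  (hgrowth : forall r : R, r0 <= r -> exists2 l3 : R, 0 < l3 &
    forall w, eball r w -> enorm (grad L w) ^+ 2 <= l3 * (1 + enorm w ^+ 2))
  (disp : measure_display) (Omega : measurableType disp)
  (P : probability Omega R) (F : R -> set (set Omega))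
  (B w : R -> Omega -> 'rV[R]_d) (sigma : R)
  (hsigma : 0 < sigma) (hF : is_filtration F) (hB : brownian_motion P F B)
  (hw : langevin_solution P F B L sigma w) :
  (forall r : R, r0 <= r -> forall T : R, 0 < T -> forall t : R, 0 <= t -> t <= T ->
    (cond_expectation P (fun omega => (L (w t omega) - Lstar)%R) (confined w r T)
     <= ((L 0 - Lstar) * expR (- l1 * t)
         + sigma * l2 * ((1 - expR (- l1 * t)) / l1))%:E
        / P (confined w r T))%E) /\
  (forall eps delta : R, 0 < eps -> 0 < delta ->
    exists2 T0 : R, 0 < T0 & forall T : R, T0 <= T ->
      ((1 - (2 * sigma * l2 / l1 / eps + delta))%:E
       <= P [set omega | (L (w T omega) - Lstar <= eps)%R])%E).
Proof.
have [_ hm] := hmin.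
(* Every point lies in an admissible ball, and [l1], [l2] are the same for all radii, so the PL and
   Laplacian bounds hold globally. *)
have eball_ex (x : 'rV[R]_d) : exists2 r, r0 <= r & eball r x.
  exists (Num.max r0 (enorm x + 1)); first by rewrite le_max lexx.
  by rewrite /eball/= lt_max ltrDl ltr01 orbT.
have PL x : l1 * (L x - Lstar) <= \sum_i pderiv i L x ^+ 2.
  have [r rr xr] := eball_ex x.
  have := hPL r rr x xr.
  rewrite div1r ler_pdivlMl// /enorm sqr_sqrtr; last first.
    by apply: sumr_ge0 => i _; exact: sqr_ge0.
  by under eq_bigr do rewrite mxE.
have lap x : laplacian L x <= l2.
  have [r rr xr] := eball_ex x.
  exact: le_trans (ler_norm _) (hlap r rr x xr).
have gap t (t0 : 0 <= t) := expected_gap_le P F B w L Lstar l1 l2 sigma hC2 hF hB hw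
  hl1 (ltW hl2) hsigma hm PL lap t t0.
split=> [r _ T _ t t0 _|eps delta eps0 delta0].
  (* The gap is nonnegative, so its integral over the event is at most its full expectation; both
     sides carry the same factor 1 / P. *)
  rewrite /cond_expectation lee_wpmul2r ?inve_ge0//.
  apply: le_trans (gap t t0); apply: ge0_integral_subset_setT => o.
  by rewrite lee_fin subr_ge0.
have g0 : 0 <= L 0 - Lstar by rewrite subr_ge0.
have D0 : 0 < l1 * eps * delta by rewrite !mulr_gt0.
(* With x = l1 T, this threshold gives L(0) - Lstar <= x eps delta, and exp(-x) (1 + x) <= 1 then
   makes the initial term at most eps delta. *)
exists (1 + (L 0 - Lstar) / (l1 * eps * delta)) => [|T TT].
  by rewrite ltr_pwDl// divr_ge0// ltW.
have T0 : 0 <= T.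
  by rewrite (le_trans _ TT)// addr_ge0// divr_ge0// ltW.
set A := [set omega | _].
have mgap : measurable_fun setT (fun o => L (w T o) - Lstar).
  exact: (gap_measurable F w L Lstar hC2 hF (langevin_adapted hw) T T0).
have mA : measurable A.
  have := mgap measurableT `]-oo, eps]%classic (measurable_itv _); rewrite setTI.
  by congr (measurable _); apply/seteqP; split=> o /=; rewrite in_itv.
have -> : P A = (1 - P (~` A))%E.
  by rewrite probability_setC// oppeB// addeA subee// add0e.
have pfin : P (~` A) \is a fin_num.
  by rewrite fin_num_measure//; exact: measurableC.
rewrite -(fineK pfin) -EFinB lee_fin lerD2l lerN2.
set p := fine _.
have markov : ((eps * p)%:E <= \int[P]_o (L (w T o) - Lstar)%:E)%E.
  apply: (@le_trans _ _ (\int[P]_(o in ~` A) (L (w T o) - Lstar)%:E)%E); last first.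
    by apply: ge0_integral_subset_setT => o; rewrite lee_fin subr_ge0.
  have mAC : measurable (~` A) by exact: measurableC.
  rewrite EFinM fineK// -integral_cst//.
  apply: ge0_le_integral => //=.
  - by move=> o _; rewrite lee_fin ltW.
  - by apply/measurable_EFinP; exact: measurable_funTS.
  - by move=> o /negP; rewrite -ltNge lee_fin => /ltW.
have := le_trans markov (gap T T0); rewrite lee_fin.
set x := l1 * T.
have ex1 : expR (- l1 * T) * (1 + x) <= 1.
  rewrite mulNr expRN ler_pdivrMl ?expR_gt0// mulr1; exact: expR_ge1Dx.
have ex0 : 0 <= expR (- l1 * T) by exact: expR_ge0.
have gx : L 0 - Lstar <= x * (eps * delta).
  have : (L 0 - Lstar) / (l1 * eps * delta) <= T by rewrite (le_trans _ TT)// lerDr.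
  by rewrite ler_pdivrMr ?mulr_gt0// /x; lra.
have h1 : (L 0 - Lstar) * expR (- l1 * T) <= eps * delta.
  rewrite (le_trans (ler_wpM2r ex0 gx))//.
  rewrite mulrAC -[leRHS]mul1r ler_wpM2r//; first by rewrite ltW// mulr_gt0.
  by move: ex1; lra.
have h2 : sigma * l2 * ((1 - expR (- l1 * T)) / l1) <= sigma * l2 / l1.
  rewrite mulrA ler_wpM2r ?invr_ge0 ?(ltW hl1)// ler_piMr//.
    by rewrite ltW// mulr_gt0.
(* The estimates give eps p <= eps delta + sigma l2 / l1; [h3] covers the passage to twice the last
   term. *)
have h3 : 0 <= sigma * l2 / l1 by rewrite ltW// !mulr_gt0// invr_gt0.
move=> h4.
have : eps * p <= eps * (2 * sigma * l2 / l1 / eps + delta).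
  rewrite mulrDr [eps * (_ / eps)]mulrC divfK ?lt0r_neq0//; lra.
by rewrite ler_pM2l.
Qed.
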